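(* Let $\tau=(\mathfrak g,\mathfrak s,\mathfrak c)$ be a hyporeductive triple over $\boldsymbol k$. Then $U_\tau$ is a hyporeductive Hopf algebra.
   Context: $\boldsymbol k$ is a field of characteristic zero. A (unital) bialgebra is a vector space $U$ with a bilinear, not necessarily associative product with unit $1$, and a coassociative cocommutative comultiplication $\Delta(u)=u_{(1)}\otimes u_{(2)}$ (Sweedler notation, summation understood) with counit $\epsilon$, such that $\Delta,\epsilon$ are homomorphisms of unital algebras. A non-associative Hopf algebra is a unital bialgebra with bilinear maps $\backslash,/$ satisfying $u_{(1)}\backslash(u_{(2)}v)=\epsilon(u)v=u_{(1)}(u_{(2)}\backslash v)$ and $(uv_{(1)})/v_{(2)}=\epsilon(v)u=(u/v_{(1)})v_{(2)}$. Unital bialgebras whose coalgebra is isomorphic to a symmetric algebra $\boldsymbol k[V]$ with its usual coalgebra structure, the unit corresponding to $1$ (connected bialgebras), are automatically non-associative Hopf algebras. A non-associative Hopf algebra $U$ is hyporeductive if: (right hypospeciality) there is a coalgebra morphism $\circ\colon U\otimes U\to U$ with $u\circ1=\epsilon(u)1=1\circ u$ and $H(u,v)(xy)=H(u_{(1)},v_{(1)})(x)\,H'(u_{(2)},v_{(2)})(y)$ for all $u,v,x,y$, where $r(u,v)(x):=((xu_{(1)})v_{(1)})/(u_{(2)}v_{(2)})$, $H(u,v)(x):=r(u_{(1)},v_{(1)})(x)\,(u_{(2)}\circ v_{(2)})$ and $H'(u,v)(y):=(u_{(1)}\circ v_{(1)})\backslash H(u_{(2)},v_{(2)})(y)$;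 and (right monoalternativity) $(((xy_{(1)})y_{(2)})\cdots)y_{(n)}=x((y_{(1)}y_{(2)})\cdots y_{(n)})$ for all $x,y$ and $n\ge0$ (left-normed products). A triple $(\mathfrak g,\mathfrak s,\mathfrak c)$ consists of a Lie algebra $\mathfrak g$, a subalgebra $\mathfrak s$ and a subspace $\mathfrak c$ with $\mathfrak g=\mathfrak s\oplus\mathfrak c$. It is hyporeductive if $\mathfrak g=N_{\mathfrak g}(\mathfrak c)+\mathfrak c$, where $N_{\mathfrak g}(\mathfrak c)=\{x\in\mathfrak g\mid[x,\mathfrak c]\subseteq\mathfrak c\}$. Construction of $U_\tau$: as a coalgebra, $U_\tau=U(\mathfrak g)/U(\mathfrak g)\mathfrak s$ (isomorphic to $\boldsymbol k[\mathfrak c]$), where $U(\mathfrak g)$ is the universal enveloping algebra; $\bar u$ denotes the class of $u$. By Poincaré–Birkhoff–Witt the classes $\sum_{\sigma\in S_n}\overline{c_{\sigma(1)}\cdots c_{\sigma(n)}}$ with $c_i\in\mathfrak c$, $n\ge0$, span $U_\tau$, and they form a basis when multisets of elements of a fixed basis of $\mathfrak c$ are used. The product on $U_\tau$ is defined by $\bar u\big(\sum_{\sigma\in S_n}\overline{c_{\sigma(1)}\cdots c_{\sigma(n)}}\big):=\sum_{\sigma\in S_n}\overline{c_{\sigma(n)}\cdots c_{\sigma(1)}u}$, with unit $\bar1$. With this product $U_\tau$ is a connected right monoalternative unital bialgebra, hence a non-associative Hopf algebra. *)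

(* Defs.v *)
From HB Require Import structures.
From mathcomp Require Import all_boot perm all_algebra generic_quotient.
From mathcomp Require Import boolp.

Set Implicit Arguments.
Unset Strict Implicit.
Unset Printing Implicit Defensive.

Import GRing.Theory.
Local Open Scope ring_scope.
Local Open Scope quotient_scope.

(* A formal sum of pairs stands for \sum_i u_i (x) v_i; two formal sums are   *)
(* identified when no bilinear map, into any vector space, separates them.    *)
(* This is the usual quotient of the free module: see tliftE and tensor_ind.  *)

Section Tensor.
Variables (k : fieldType) (U V : lmodType k).

Definition tsum (W : lmodType k) (f : U -> V -> W) (s : seq (U * V)) : W :=
  \sum_(p <- s) f p.1 p.2.

Definition tens_equiv : rel (seq (U * V)) := fun s t =>
  `[< forall (W : lmodType k) (f : {bilinear U -> V -> W}),
        tsum f s = tsum f t >].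

Lemma tens_equiv_is_equiv : equiv_class_of tens_equiv.
Proof.
split=> [s|s t|s t r].
- exact/asboolP.
- by apply/asboolP/asboolP => h W f; rewrite h.
- by move=> /asboolP h1 /asboolP h2; apply/asboolP => W f; rewrite h1.
Qed.

Canonical tens_equiv_equiv := EquivRelPack tens_equiv_is_equiv.

Definition tensor := {eq_quot tens_equiv}.
HB.instance Definition _ := Choice.on tensor.
HB.instance Definition _ := EqQuotient.on tensor.

Definition tpure (u : U) (v : V) : tensor := \pi_tensor [:: (u, v)].

(* Sweedler-style evaluation of f on t = \sum u_i (x) v_i, computed on a      *)
(* chosen representative; independent of that choice when f is bilinear.      *)
Definition tlift (W : lmodType k) (f : U -> V -> W) (t : tensor) : W :=
  tsum f (repr t).

Lemma tsum_cat W f s t : @tsum W f (s ++ t) = tsum f s + tsum f t.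
Proof. exact: big_cat. Qed.

Lemma tlift_pi (W : lmodType k) (f : {bilinear U -> V -> W}) s :
  tlift f (\pi_tensor s) = tsum f s.
Proof.
have /eqmodP/asboolP : repr (\pi_tensor s) = s %[mod tensor] by rewrite reprK.
by apply.
Qed.

Lemma tensorP (t t' : tensor) :
  (forall (W : lmodType k) (f : {bilinear U -> V -> W}),
      tlift f t = tlift f t') -> t = t'.
Proof.
move=> h; rewrite -[t]reprK -[t']reprK; apply/eqmodP/asboolP => W f; exact: h.
Qed.

Definition tadd (t t' : tensor) : tensor := \pi_tensor (repr t ++ repr t').
Definition topp (t : tensor) : tensor :=
  \pi_tensor [seq (- p.1, p.2) | p <- repr t].
Definition tscale (a : k) (t : tensor) : tensor :=
  \pi_tensor [seq (a *: p.1, p.2) | p <- repr t].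

Lemma tlift_add (W : lmodType k) (f : {bilinear U -> V -> W}) t t' :
  tlift f (tadd t t') = tlift f t + tlift f t'.
Proof. by rewrite /tadd tlift_pi tsum_cat. Qed.

Lemma tlift_opp (W : lmodType k) (f : {bilinear U -> V -> W}) t :
  tlift f (topp t) = - tlift f t.
Proof.
rewrite /topp tlift_pi /tlift /tsum big_map -sumrN.
by apply: eq_bigr => p _; rewrite linearNl.
Qed.

Lemma tlift_scale (W : lmodType k) (f : {bilinear U -> V -> W}) a t :
  tlift f (tscale a t) = a *: tlift f t.
Proof.
rewrite /tscale tlift_pi /tlift /tsum big_map scaler_sumr.
by apply: eq_bigr => p _; rewrite linearZl_LR.
Qed.

Lemma tlift_zero (W : lmodType k) (f : {bilinear U -> V -> W}) :
  tlift f (\pi_tensor [::]) = 0.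
Proof. by rewrite tlift_pi /tsum big_nil. Qed.

Let taddA : associative tadd.
Proof. by move=> x y z; apply: tensorP => W f; rewrite !tlift_add addrA. Qed.
Let taddC : commutative tadd.
Proof. by move=> x y; apply: tensorP => W f; rewrite !tlift_add addrC. Qed.
Let tadd0 : left_id (\pi_tensor [::]) tadd.
Proof.
by move=> x; apply: tensorP => W f; rewrite !tlift_add tlift_zero add0r.
Qed.
Let taddN : left_inverse (\pi_tensor [::]) topp tadd.
Proof.
by move=> x; apply: tensorP => W f; rewrite !tlift_add tlift_zero tlift_opp addNr.
Qed.

HB.instance Definition _ := GRing.isZmodule.Build tensor taddA taddC tadd0 taddN.

Let tscaleA a b t : tscale a (tscale b t) = tscale (a * b) t.
Proof. by apply: tensorP => W f; rewrite !tlift_scale scalerA. Qed.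
Let tscale1 : left_id 1 tscale.
Proof. by move=> t; apply: tensorP => W f; rewrite !tlift_scale scale1r. Qed.
Let tscaleDr : right_distributive tscale +%R.
Proof.
by move=> a x y; apply: tensorP => W f; rewrite !(tlift_scale, tlift_add) scalerDr.
Qed.
Let tscaleDl t : {morph tscale^~ t : a b / a + b}.
Proof.
by move=> a b; apply: tensorP => W f; rewrite !(tlift_scale, tlift_add) scalerDl.
Qed.

HB.instance Definition _ :=
  GRing.Zmodule_isLmodule.Build k tensor tscaleA tscale1 tscaleDr tscaleDl.

Lemma tlift_is_linear (W : lmodType k) (f : {bilinear U -> V -> W}) :
  linear (tlift f).
Proof. by move=> a x y; rewrite tlift_add tlift_scale. Qed.
HB.instance Definition _ (W : lmodType k) (f : {bilinear U -> V -> W}) :=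
  GRing.isLinear.Build k tensor W *:%R (tlift f) (tlift_is_linear f).

Lemma tliftE (W : lmodType k) (f : {bilinear U -> V -> W}) u v :
  tlift f (tpure u v) = f u v.
Proof. by rewrite tlift_pi /tsum big_seq1. Qed.

Lemma tpure_is_bilinear : bilinear_for *:%R *:%R tpure.
Proof.
split=> [v|u] a x y; apply: tensorP => W f.
  by rewrite linearP /= !tliftE linearPl.
by rewrite linearP /= !tliftE linearPr.
Qed.
HB.instance Definition _ :=
  bilinear_isBilinear.Build k U V tensor *:%R *:%R tpure tpure_is_bilinear.

Lemma tensor_sum (t : tensor) : t = \sum_(p <- repr t) tpure p.1 p.2.
Proof.
apply: tensorP => W f; rewrite linear_sum.
by apply: eq_bigr => p _ /=; rewrite tliftE.
Qed.

Lemma tensor_ind (P : tensor -> Prop) :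
  P 0 -> (forall x y, P x -> P y -> P (x + y)) -> (forall u v, P (tpure u v)) ->
  forall t, P t.
Proof.
move=> P0 PD Pp t; rewrite [t]tensor_sum.
by elim/big_ind: _ => // p _; apply: Pp.
Qed.

Lemma tensor_ext (W : lmodType k) (f g : {linear tensor -> W}) :
  (forall u v, f (tpure u v) = g (tpure u v)) -> f =1 g.
Proof.
move=> h; apply: tensor_ind => // [|x y ex ey]; first by rewrite !linear0.
by rewrite !linearD ex ey.
Qed.

End Tensor.

Notation "u '\ot' v" := (tpure u v) (at level 40, left associativity).
Notation "'\sw_' ( a , b '<-' t ) E" := (tlift (fun a b => E) t)
  (at level 41, a name, b name, t at level 99, E at level 41,
   format "'\sw_' ( a ,  b  '<-'  t )  E").

Section TensorMaps.
Variable k : fieldType.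

(* (a (x) b) (a' (x) b') = a a' (x) b b'                                      *)
Definition tmul (A : lmodType k) (mul : A -> A -> A) (s t : tensor A A) :
    tensor A A :=
  \sw_(a, b <- s) \sw_(a', b' <- t) (mul a a' \ot mul b b').

Section Map.
Variables (U V W X : lmodType k) (f : {linear U -> W}) (g : {linear V -> X}).
Definition tmap_body u v : tensor W X := f u \ot g v.
Lemma tmap_body_bilinear : bilinear_for *:%R *:%R tmap_body.
Proof.
split=> [v|u] a x y; rewrite /tmap_body linearP; first exact: linearPl.
exact: linearPr.
Qed.
HB.instance Definition _ := bilinear_isBilinear.Build k U V (tensor W X)
  *:%R *:%R tmap_body tmap_body_bilinear.

Definition tmap : tensor U V -> tensor W X := tlift tmap_body.
HB.instance Definition _ := GRing.Linear.on tmap.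

Lemma tmapE u v : tmap (u \ot v) = f u \ot g v.
Proof. exact: tliftE. Qed.
End Map.

Section Mul.
Variables (A : lmodType k) (mul : {bilinear A -> A -> A}).
Section Body.
Variables (a b : A).
Definition tmul_body (a' b' : A) : tensor A A := mul a a' \ot mul b b'.
Lemma tmul_body_bilinear : bilinear_for *:%R *:%R tmul_body.
Proof.
split=> [v|u] c x y; rewrite /tmul_body linearPr; first exact: linearPl.
exact: linearPr.
Qed.
HB.instance Definition _ := bilinear_isBilinear.Build k A A (tensor A A)
  *:%R *:%R tmul_body tmul_body_bilinear.
End Body.
Section Body2.
Variable t : tensor A A.
Definition tmul_body2 (a b : A) : tensor A A := tlift (tmul_body a b) t.
Lemma tmul_body2_bilinear : bilinear_for *:%R *:%R tmul_body2.
Proof.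
rewrite /tmul_body2; elim/tensor_ind: t => [|x y [xl xr] [yl yr]|u v].
- by split=> [v|u] c x y; rewrite !linear0 /= scaler0 addr0.
- split=> [v|u] c p q; rewrite !linearD.
    by rewrite [X in X + _ = _]xl [X in _ + X = _]yl /= scalerDr addrACA.
  by rewrite [X in X + _ = _]xr [X in _ + X = _]yr /= scalerDr addrACA.
- split=> [b|a] c x y; rewrite !tliftE /= /tmul_body linearPl /=.
    exact: linearPl.
  exact: linearPr.
Qed.
HB.instance Definition _ := bilinear_isBilinear.Build k A A (tensor A A)
  *:%R *:%R tmul_body2 tmul_body2_bilinear.
End Body2.

Lemma tmul_bilinear : bilinear_for *:%R *:%R (tmul mul).
Proof.
split=> [t|s]; first exact: (tlift_is_linear (tmul_body2 t)).
have E r t : tmul mul r t = tlift (tmul_body2 t) r by [].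
move=> c x y; rewrite !E; elim/tensor_ind: s => [|s1 s2 h1 h2|a b].
- by rewrite !linear0 /= scaler0 addr0.
- by rewrite !linearD /= h1 h2 /= scalerDr addrACA.
- by rewrite !tliftE /= /tmul_body2 linearP.
Qed.
HB.instance Definition _ := bilinear_isBilinear.Build k (tensor A A) (tensor A A)
  (tensor A A) *:%R *:%R (tmul mul) tmul_bilinear.

Lemma tmulE a b a' b' :
  tmul mul (a \ot b) (a' \ot b') = mul a a' \ot mul b b'.
Proof.
transitivity (tmul_body2 (a' \ot b') a b); last exact: tliftE.
exact: (tliftE (tmul_body2 (a' \ot b'))).
Qed.
End Mul.

End TensorMaps.

HB.mixin Record Lmodule_isLie (k : fieldType) g of GRing.Lmodule k g := {
  lbr : g -> g -> g;
  lbr_linearl : forall y : g, linear (lbr^~ y);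
  lbr_linearr : forall x : g, linear (lbr x);
  lbrxx : forall x : g, lbr x x = 0;
  lbr_jacobi : forall x y z : g,
    lbr x (lbr y z) + lbr y (lbr z x) + lbr z (lbr x y) = 0
}.

#[short(type="lieAlgType")]
HB.structure Definition LieAlg (k : fieldType) :=
  {g of GRing.Lmodule k g & Lmodule_isLie k g}.

Notation "[ 'lie' x , y ]" := (lbr x y)
  (at level 0, x at level 99, y at level 99, format "[ 'lie'  x ,  y ]").

(* A noncommutative polynomial \sum_i a_i x_i1 ... x_ir in elements of g is   *)
(* coded by the list of the (a_i, [:: x_i1; ...; x_ir]).  Two of them are     *)
(* identified when every Lie algebra morphism from g to an associative        *)
(* algebra gives them the same value.  The universal property of U(g) is      *)
(* given by uea_inj_hom, uea_liftP, uea_lift_inj and uea_lift_unique.         *)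

Definition lie_hom (k : fieldType) (g : lieAlgType k) (B : algType k)
    (f : g -> B) : Prop :=
  linear f /\ forall x y : g, f [lie x, y] = f x * f y - f y * f x.

Section UEA.
Variables (k : fieldType) (g : lieAlgType k).

Definition ncpoly := seq (k * seq g).

Definition nceval (B : algType k) (f : g -> B) (s : ncpoly) : B :=
  \sum_(p <- s) p.1 *: \prod_(x <- p.2) f x.

Definition uea_equiv : rel ncpoly := fun s t =>
  `[< forall (B : algType k) (f : g -> B), lie_hom f ->
        nceval f s = nceval f t >].

Lemma uea_equiv_is_equiv : equiv_class_of uea_equiv.
Proof.
split=> [s|s t|s t r].
- exact/asboolP.
- by apply/asboolP/asboolP => h B f hf; rewrite h.
- by move=> /asboolP h1 /asboolP h2; apply/asboolP => B f hf; rewrite h1 ?h2.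
Qed.

Canonical uea_equiv_equiv := EquivRelPack uea_equiv_is_equiv.

Definition uea := {eq_quot uea_equiv}.
HB.instance Definition _ := Choice.on uea.
HB.instance Definition _ := EqQuotient.on uea.

Definition uea_inj (x : g) : uea := \pi_uea [:: (1, [:: x])].

Definition uea_lift (B : algType k) (f : g -> B) (u : uea) : B :=
  nceval f (repr u).

Lemma uea_lift_pi (B : algType k) (f : g -> B) s :
  lie_hom f -> uea_lift f (\pi_uea s) = nceval f s.
Proof.
move=> hf.
have /eqmodP/asboolP : repr (\pi_uea s) = s %[mod uea] by rewrite reprK.
exact.
Qed.

Lemma ueaP (u v : uea) :
  (forall (B : algType k) (f : g -> B), lie_hom f ->
     uea_lift f u = uea_lift f v) -> u = v.
Proof.
move=> h; rewrite -[u]reprK -[v]reprK; apply/eqmodP/asboolP => B f; exact: h.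
Qed.

Definition uea_add (u v : uea) : uea := \pi_uea (repr u ++ repr v).
Definition uea_scale (a : k) (u : uea) : uea :=
  \pi_uea [seq (a * p.1, p.2) | p <- repr u].
Definition uea_opp (u : uea) : uea := uea_scale (- 1) u.
Definition uea_mul (u v : uea) : uea :=
  \pi_uea [seq (p.1 * q.1, p.2 ++ q.2) | p <- repr u, q <- repr v].

Section Eval.
Variables (B : algType k) (f : g -> B) (hf : lie_hom f).

Lemma uea_lift_add u v : uea_lift f (uea_add u v) = uea_lift f u + uea_lift f v.
Proof. by rewrite /uea_add uea_lift_pi // /nceval big_cat. Qed.

Lemma uea_lift_scale a u : uea_lift f (uea_scale a u) = a *: uea_lift f u.
Proof.
rewrite /uea_scale uea_lift_pi // /nceval big_map scaler_sumr.
by apply: eq_bigr => p _; rewrite scalerA.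
Qed.

Lemma uea_lift_opp u : uea_lift f (uea_opp u) = - uea_lift f u.
Proof. by rewrite uea_lift_scale scaleN1r. Qed.

Lemma uea_lift_mul u v : uea_lift f (uea_mul u v) = uea_lift f u * uea_lift f v.
Proof.
rewrite /uea_mul uea_lift_pi // /uea_lift /nceval big_allpairs_dep mulr_suml.
apply: eq_bigr => p _; rewrite mulr_sumr; apply: eq_bigr => q _ /=.
by rewrite big_cat /= -scalerAl -scalerAr scalerA.
Qed.

Lemma uea_lift_zero : uea_lift f (\pi_uea [::]) = 0.
Proof. by rewrite uea_lift_pi // /nceval big_nil. Qed.

Lemma uea_lift_one : uea_lift f (\pi_uea [:: (1, [::])]) = 1.
Proof. by rewrite uea_lift_pi // /nceval big_seq1 big_nil scale1r. Qed.

Lemma uea_lift_inj x : uea_lift f (uea_inj x) = f x.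
Proof. by rewrite uea_lift_pi // /nceval !big_seq1 scale1r. Qed.
End Eval.

Let uE := (uea_lift_add, uea_lift_scale, uea_lift_opp, uea_lift_mul,
           uea_lift_zero, uea_lift_one).

Let uaddA : associative uea_add.
Proof. by move=> x y z; apply: ueaP => B f hf; rewrite !uE // addrA. Qed.
Let uaddC : commutative uea_add.
Proof. by move=> x y; apply: ueaP => B f hf; rewrite !uE // addrC. Qed.
Let uadd0 : left_id (\pi_uea [::]) uea_add.
Proof. by move=> x; apply: ueaP => B f hf; rewrite !uE // add0r. Qed.
Let uaddN : left_inverse (\pi_uea [::]) uea_opp uea_add.
Proof. by move=> x; apply: ueaP => B f hf; rewrite !uE // addNr. Qed.

HB.instance Definition _ := GRing.isZmodule.Build uea uaddA uaddC uadd0 uaddN.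

Let umulA : associative uea_mul.
Proof. by move=> x y z; apply: ueaP => B f hf; rewrite !uE // mulrA. Qed.
Let umul1 : left_id (\pi_uea [:: (1, [::])]) uea_mul.
Proof. by move=> x; apply: ueaP => B f hf; rewrite !uE // mul1r. Qed.
Let umulr1 : right_id (\pi_uea [:: (1, [::])]) uea_mul.
Proof. by move=> x; apply: ueaP => B f hf; rewrite !uE // mulr1. Qed.
Let umulDl : left_distributive uea_mul +%R.
Proof. by move=> x y z; apply: ueaP => B f hf; rewrite !uE // mulrDl. Qed.
Let umulDr : right_distributive uea_mul +%R.
Proof. by move=> x y z; apply: ueaP => B f hf; rewrite !uE // mulrDr. Qed.

Lemma lie_hom0 : lie_hom (fun _ : g => 0 : k^o).
Proof. by split=> [a x y|x y]; rewrite ?scaler0 ?addr0 ?mul0r ?subrr. Qed.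

Let u1_neq0 : \pi_uea [:: (1, [::])] != 0 :> uea.
Proof.
apply/eqP => /(congr1 (uea_lift (fun _ : g => 0 : k^o))) /eqP.
by rewrite (uea_lift_one lie_hom0) (uea_lift_zero lie_hom0) oner_eq0.
Qed.

HB.instance Definition _ := GRing.Zmodule_isNzRing.Build uea
  umulA umul1 umulr1 umulDl umulDr u1_neq0.

Let uscaleA a b t : uea_scale a (uea_scale b t) = uea_scale (a * b) t.
Proof. by apply: ueaP => B f hf; rewrite !uE // scalerA. Qed.
Let uscale1 : left_id 1 uea_scale.
Proof. by move=> t; apply: ueaP => B f hf; rewrite !uE // scale1r. Qed.
Let uscaleDr : right_distributive uea_scale +%R.
Proof. by move=> a x y; apply: ueaP => B f hf; rewrite !uE // scalerDr. Qed.
Let uscaleDl t : {morph uea_scale^~ t : a b / a + b}.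
Proof. by move=> a b; apply: ueaP => B f hf; rewrite !uE // scalerDl. Qed.

HB.instance Definition _ :=
  GRing.Zmodule_isLmodule.Build k uea uscaleA uscale1 uscaleDr uscaleDl.

Let uscaleAl (a : k) (x y : uea) : a *: (x * y) = (a *: x) * y.
Proof. by apply: ueaP => B f hf; rewrite !uE // scalerAl. Qed.
Let uscaleAr (a : k) (x y : uea) : a *: (x * y) = x * (a *: y).
Proof. by apply: ueaP => B f hf; rewrite !uE // scalerAr. Qed.

HB.instance Definition _ := GRing.Lmodule_isLalgebra.Build k uea uscaleAl.
HB.instance Definition _ := GRing.Lalgebra_isAlgebra.Build k uea uscaleAr.

Lemma uea_inj_hom : lie_hom uea_inj.
Proof.
split=> [a x y|x y]; apply: ueaP => B f hf.
  by rewrite !(uE, uea_lift_inj) //; case: hf => [hl _]; rewrite hl.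
by rewrite !(uE, uea_lift_inj) //; case: hf => [_ hb]; rewrite hb ?scaleN1r.
Qed.

Lemma uea_liftP (B : algType k) (f : g -> B) : lie_hom f ->
  linear (uea_lift f) /\ monoid_morphism (uea_lift f).
Proof.
move=> hf; split=> [a x y|]; first by rewrite !uE.
by split=> [|x y]; rewrite !uE.
Qed.

Lemma uea_sum (u : uea) :
  u = \sum_(p <- repr u) p.1 *: \prod_(x <- p.2) uea_inj x.
Proof.
apply: ueaP => B f hf; have [fl fm] := uea_liftP hf.
pose F : {lrmorphism uea -> B} := HB.pack (uea_lift f)
  (GRing.isLinear.Build k uea B *:%R (uea_lift f) fl)
  (GRing.isMonoidMorphism.Build uea B (uea_lift f) fm).
rewrite -[uea_lift f (\sum_(_ <- _) _)]/(F _) linear_sum.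
apply: eq_bigr => p _; rewrite linearZ rmorph_prod; congr (_ *: _).
by apply: eq_bigr => x _; rewrite /= uea_lift_inj.
Qed.

Lemma uea_lift_unique (B : algType k) (f : g -> B) (F : {lrmorphism uea -> B}) :
  (forall x, F (uea_inj x) = f x) -> F =1 uea_lift f.
Proof.
move=> Ff u; rewrite [u in LHS]uea_sum linear_sum /uea_lift.
apply: eq_bigr => p _; rewrite linearZ rmorph_prod; congr (_ *: _).
by apply: eq_bigr => x _; rewrite -Ff.
Qed.

Lemma uea_ind (P : uea -> Prop) :
  P 1 -> (forall x y, P x -> P y -> P (x + y)) ->
  (forall a x, P x -> P (a *: x)) ->
  (forall x u, P u -> P (uea_inj x * u)) -> forall u, P u.
Proof.
move=> P1 PD PZ Pi u; rewrite [u]uea_sum; elim: (repr u : ncpoly) => [|p s IH].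
  by rewrite big_nil -(scale0r 1); apply: PZ.
rewrite big_cons; apply: PD IH; apply: PZ.
elim: p.2 => [|x w IH]; rewrite ?big_nil // big_cons; exact: Pi.
Qed.

Definition uea_counit (u : uea) : k := uea_lift (fun _ => 0 : k^o) u.

Lemma uea_counit_linear : linear_for *%R uea_counit.
Proof. exact: (uea_liftP lie_hom0).1. Qed.
Lemma uea_counit_monoid : monoid_morphism uea_counit.
Proof. exact: (uea_liftP lie_hom0).2. Qed.
HB.instance Definition _ :=
  GRing.isLinear.Build k uea k *%R uea_counit uea_counit_linear.
HB.instance Definition _ :=
  GRing.isMonoidMorphism.Build uea k uea_counit uea_counit_monoid.

Lemma uea_counit_inj x : uea_counit (uea_inj x) = 0.
Proof. exact: (uea_lift_inj lie_hom0). Qed.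

End UEA.

Arguments uea_inj {k g}.
Arguments uea_counit {k g}.

Section AlgMul.
Variables (k : fieldType) (A : algType k).
Definition amul (x y : A) : A := x * y.
Lemma amul_bilinear : bilinear_for *:%R *:%R amul.
Proof.
split=> [y|x] c u v; rewrite /amul; first by rewrite mulrDl -scalerAl.
by rewrite mulrDr -scalerAr.
Qed.
HB.instance Definition _ :=
  bilinear_isBilinear.Build k A A A *:%R *:%R amul amul_bilinear.
End AlgMul.

Section UEATensor.
Variables (k : fieldType) (g : lieAlgType k).
Let A := uea g.
Let AA := tensor A A.
Let mul : AA -> AA -> AA := tmul (@amul k A).
Let one : AA := 1 \ot 1.

Let tm_mulA : associative mul.
Proof.
rewrite /mul; move=> x y z; elim/tensor_ind: x => [|x1 x2 h1 h2|a b].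
- by rewrite !linear0l.
- by rewrite !linearDl /= h1 h2.
elim/tensor_ind: y => [|x1 x2 h1 h2|a' b'].
- by rewrite !(linear0l, linear0r).
- by rewrite !(linearDl, linearDr) /= h1 h2.
elim/tensor_ind: z => [|x1 x2 h1 h2|a'' b''].
- by rewrite !linear0r.
- by rewrite !linearDr /= h1 h2.
by rewrite !tmulE /= /amul !mulrA.
Qed.
Let tm_mul1 : left_id one mul.
Proof.
rewrite /mul; elim/tensor_ind => [|x1 x2 h1 h2|a b]; first exact: linear0r.
  by rewrite linearDr /= h1 h2.
by rewrite tmulE /= /amul !mul1r.
Qed.
Let tm_mulr1 : right_id one mul.
Proof.
rewrite /mul; elim/tensor_ind => [|x1 x2 h1 h2|a b]; first exact: linear0l.
  by rewrite linearDl /= h1 h2.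
by rewrite tmulE /= /amul !mulr1.
Qed.
Let tm_mulDl : left_distributive mul +%R.
Proof. by move=> x y z; rewrite /mul linearDl. Qed.
Let tm_mulDr : right_distributive mul +%R.
Proof. by move=> x y z; rewrite /mul linearDr. Qed.

Definition uea_counit2 (u v : A) : k^o := uea_counit u * uea_counit v.
Lemma uea_counit2_bilinear : bilinear_for *:%R *:%R uea_counit2.
Proof.
split=> [v|u] c x y; rewrite /uea_counit2 linearP /=.
  by rewrite mulrDl -mulrA.
by rewrite mulrDr mulrCA.
Qed.
HB.instance Definition _ := bilinear_isBilinear.Build k A A k^o *:%R *:%R
  uea_counit2 uea_counit2_bilinear.

Let one_neq0 : one != 0.
Proof.
apply/eqP => /(congr1 (tlift uea_counit2)) /eqP.
by rewrite tliftE linear0 /= /uea_counit2 !rmorph1 mulr1 oner_eq0.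
Qed.

HB.instance Definition _ := GRing.Zmodule_isNzRing.Build (tensor (uea g) (uea g))
  tm_mulA tm_mul1 tm_mulr1 tm_mulDl tm_mulDr one_neq0.

Let tm_scaleAl (a : k) (x y : AA) : a *: (x * y) = (a *: x) * y.
Proof. by rewrite -[RHS]/(mul _ _) /mul linearZl_LR. Qed.
Let tm_scaleAr (a : k) (x y : AA) : a *: (x * y) = x * (a *: y).
Proof. by rewrite -[RHS]/(mul _ _) /mul linearZr_LR. Qed.

HB.instance Definition _ :=
  GRing.Lmodule_isLalgebra.Build k (tensor (uea g) (uea g)) tm_scaleAl.
HB.instance Definition _ :=
  GRing.Lalgebra_isAlgebra.Build k (tensor (uea g) (uea g)) tm_scaleAr.

Lemma uea_tensorM (a b c d : uea g) :
  (a \ot b) * (c \ot d) = (a * c) \ot (b * d).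
Proof. exact: tmulE. Qed.

Lemma uea_prim_hom :
  lie_hom (fun x : g => uea_inj x \ot 1 + 1 \ot uea_inj x : tensor (uea g) (uea g)).
Proof.
have [il ib] := uea_inj_hom g; split=> [a x y|x y].
  by rewrite il linearPl linearPr scalerDr addrACA.
rewrite ib linearBl linearBr !(mulrDl, mulrDr) !uea_tensorM !(mul1r, mulr1) /=.
set X := uea_inj x; set Y := uea_inj y.
have E (a b c d p q : AA) :
    a - b + (c - d) = a + p + (q + c) - (b + q + (p + d)).
  by rewrite [b + q + _]addrACA opprD [RHS]addrACA [b + p]addrC addrKA
             [q + c]addrC addrKA.
exact: E.
Qed.

Definition uea_comul : uea g -> tensor (uea g) (uea g) :=
  uea_lift (fun x => uea_inj x \ot 1 + 1 \ot uea_inj x).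

Lemma uea_comul_linear : linear uea_comul.
Proof. exact: (uea_liftP uea_prim_hom).1. Qed.
Lemma uea_comul_monoid : monoid_morphism uea_comul.
Proof. exact: (uea_liftP uea_prim_hom).2. Qed.
HB.instance Definition _ := GRing.isLinear.Build k (uea g)
  (tensor (uea g) (uea g)) *:%R uea_comul uea_comul_linear.
HB.instance Definition _ := GRing.isMonoidMorphism.Build (uea g)
  (tensor (uea g) (uea g)) uea_comul uea_comul_monoid.

Lemma uea_comul_inj x :
  uea_comul (uea_inj x) = uea_inj x \ot 1 + 1 \ot uea_inj x.
Proof. exact: (uea_lift_inj uea_prim_hom). Qed.
End UEATensor.

Arguments uea_comul {k g}.

(* In the definitions below each \sw is applied to an expression which is     *)
(* bilinear in its two bound variables, so that representatives do not matter.*)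

Section NAHopf.
Variables (k : fieldType) (U : lmodType k).
Variables (mul : {bilinear U -> U -> U}) (one : U).
Variables (D : {linear U -> tensor U U}) (e : {scalar U}).

Record unital_bialgebra : Prop := UnitalBialgebra {
  bialg_mul1u : forall u, mul one u = u;
  bialg_mulu1 : forall u, mul u one = u;
  bialg_coassoc : forall u,
    \sw_(a, b <- D u) \sw_(a1, a2 <- D a) (a1 \ot (a2 \ot b)) =
    \sw_(a, b <- D u) (a \ot D b);
  bialg_cocomm : forall u, \sw_(a, b <- D u) (b \ot a) = D u;
  bialg_counitl : forall u, \sw_(a, b <- D u) (e a *: b) = u;
  bialg_counitr : forall u, \sw_(a, b <- D u) (e b *: a) = u;
  bialg_comul1 : D one = one \ot one;
  bialg_comulM : forall u v, D (mul u v) = tmul mul (D u) (D v);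
  bialg_counit1 : e one = 1;
  bialg_counitM : forall u v, e (mul u v) = e u * e v
}.

Section Divisions.
(* ld u v = u \ v and rd u v = u / v                                          *)
Variables (ld rd : {bilinear U -> U -> U}).

Record nahopf : Prop := NAHopf {
  nahopf_bialg : unital_bialgebra;
  nahopf_ldM : forall u v, \sw_(u1, u2 <- D u) ld u1 (mul u2 v) = e u *: v;
  nahopf_Mld : forall u v, \sw_(u1, u2 <- D u) mul u1 (ld u2 v) = e u *: v;
  nahopf_Mrd : forall u v, \sw_(v1, v2 <- D v) rd (mul u v1) v2 = e v *: u;
  nahopf_rdM : forall u v, \sw_(v1, v2 <- D v) mul (rd u v1) v2 = e v *: u
}.

Definition r_op (u v x : U) : U :=
  \sw_(u1, u2 <- D u) \sw_(v1, v2 <- D v)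
    rd (mul (mul x u1) v1) (mul u2 v2).

Definition H_op (circ : tensor U U -> U) (u v x : U) : U :=
  \sw_(u1, u2 <- D u) \sw_(v1, v2 <- D v)
    mul (r_op u1 v1 x) (circ (u2 \ot v2)).

Definition H'_op (circ : tensor U U -> U) (u v y : U) : U :=
  \sw_(u1, u2 <- D u) \sw_(v1, v2 <- D v)
    ld (circ (u1 \ot v1)) (H_op circ u2 v2 y).

(* circ is a coalgebra morphism for the usual structure on U (x) U:           *)
(* u (x) v |-> (u_(1) (x) v_(1)) (x) (u_(2) (x) v_(2)), with counit e (x) e.  *)
Definition tensor_comul (t : tensor U U) : tensor (tensor U U) (tensor U U) :=
  \sw_(u, v <- t) \sw_(u1, u2 <- D u) \sw_(v1, v2 <- D v)
    ((u1 \ot v1) \ot (u2 \ot v2)).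

Definition tensor_counit (t : tensor U U) : k :=
  \sw_(u, v <- t) (e u * e v : k^o).

Definition coalg_morphism (circ : {linear tensor U U -> U}) : Prop :=
  (forall t, D (circ t) = tmap circ circ (tensor_comul t)) /\
  (forall t, e (circ t) = tensor_counit t).

Definition right_hypospecial : Prop :=
  exists circ : {linear tensor U U -> U},
    [/\ coalg_morphism circ,
        forall u, circ (u \ot one) = e u *: one,
        forall u, circ (one \ot u) = e u *: one
      & forall u v x y,
          H_op circ u v (mul x y) =
          \sw_(u1, u2 <- D u) \sw_(v1, v2 <- D v)
            mul (H_op circ u1 v1 x) (H'_op circ u2 v2 y)].
End Divisions.

(* lnprod n x y = (((x y_(1)) y_(2)) ...) y_(n), which is e(y) x for n = 0.   *)
(* Since one is the unit, lnprod n one y = (y_(1) y_(2)) ... y_(n).           *)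
Fixpoint lnprod (n : nat) (x y : U) : U :=
  if n is n'.+1 then \sw_(y1, y2 <- D y) mul (lnprod n' x y1) y2
  else e y *: x.

Definition right_monoalternative : Prop :=
  forall (n : nat) (x y : U), lnprod n x y = mul x (lnprod n one y).

Definition hyporeductive_hopf : Prop :=
  exists ld rd : {bilinear U -> U -> U},
    [/\ nahopf ld rd, right_hypospecial ld rd & right_monoalternative].

End NAHopf.

Section Triple.
Variables (k : fieldType) (g : lieAlgType k) (s c : {pred g}).

Record lie_triple : Prop := LieTriple {
  triple_s_submod : submod_closed s;
  triple_s_lie : {in s &, forall x y, [lie x, y] \in s};
  triple_c_submod : submod_closed c;
  triple_sum : forall x, exists a b, [/\ a \in s, b \in c & x = a + b];
  triple_direct : forall x, x \in s -> x \in c -> x = 0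
}.

Definition lie_normalizer (x : g) : Prop := forall y, y \in c -> [lie x, y] \in c.

Definition hyporeductive_triple : Prop :=
  lie_triple /\
  forall x, exists a b, [/\ lie_normalizer a, b \in c & x = a + b].

(* U(g) s                                                                     *)
Definition left_ideal (u : uea g) : Prop :=
  exists l : seq (uea g * g),
    (forall p, p \in l -> p.2 \in s) /\ u = \sum_(p <- l) p.1 * uea_inj p.2.

Lemma left_ideal0 : left_ideal 0.
Proof. by exists [::]; split=> //; rewrite big_nil. Qed.

Lemma left_idealD u v : left_ideal u -> left_ideal v -> left_ideal (u + v).
Proof.
move=> [l [hl ->]] [m [hm ->]]; exists (l ++ m); split; last by rewrite big_cat.
by move=> p; rewrite mem_cat => /orP[/hl|/hm].
Qed.

Lemma left_idealM w u : left_ideal u -> left_ideal (w * u).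
Proof.
move=> [l [hl ->]]; exists [seq (w * p.1, p.2) | p <- l]; split.
  by move=> _ /mapP[p /hl ps ->].
by rewrite big_map mulr_sumr; apply: eq_bigr => p _; rewrite mulrA.
Qed.

Lemma left_idealZ a u : left_ideal u -> left_ideal (a *: u).
Proof. by rewrite -mulr_algl; apply: left_idealM. Qed.

Lemma left_idealN u : left_ideal u -> left_ideal (- u).
Proof. by rewrite -scaleN1r; apply: left_idealZ. Qed.

Definition Utau_equiv : rel (uea g) := fun u v => `[< left_ideal (u - v) >].

Lemma Utau_equiv_is_equiv : equiv_class_of Utau_equiv.
Proof.
split=> [u|u v|u v w].
- by apply/asboolP; rewrite subrr; apply: left_ideal0.
- by apply/asboolP/asboolP => /left_idealN; rewrite opprB.
- move=> /asboolP h1 /asboolP h2; apply/asboolP.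
  have -> : v - w = (v - u) + (u - w) by rewrite addrA subrK.
  exact: left_idealD.
Qed.

Canonical Utau_equiv_equiv := EquivRelPack Utau_equiv_is_equiv.

Definition Utau := {eq_quot Utau_equiv}.
HB.instance Definition _ := Choice.on Utau.
HB.instance Definition _ := EqQuotient.on Utau.

Definition Utau_class (u : uea g) : Utau := \pi_Utau u.

Lemma Utau_classP u v : Utau_class u = Utau_class v <-> left_ideal (u - v).
Proof.
split=> [/eqmodP/asboolP //|h]; apply/eqmodP; exact/asboolP.
Qed.

Lemma Utau_reprP u : left_ideal (repr (Utau_class u) - u).
Proof. by apply/Utau_classP; rewrite /Utau_class reprK. Qed.

Definition Utau_add (x y : Utau) : Utau := Utau_class (repr x + repr y).
Definition Utau_opp (x : Utau) : Utau := Utau_class (- repr x).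
Definition Utau_scale (a : k) (x : Utau) : Utau := Utau_class (a *: repr x).

Lemma Utau_addE u v :
  Utau_add (Utau_class u) (Utau_class v) = Utau_class (u + v).
Proof.
apply/Utau_classP; rewrite opprD addrACA.
by apply: left_idealD; apply: Utau_reprP.
Qed.

Lemma Utau_oppE u : Utau_opp (Utau_class u) = Utau_class (- u).
Proof. by apply/Utau_classP; rewrite -opprD; apply/left_idealN/Utau_reprP. Qed.

Lemma Utau_scaleE a u : Utau_scale a (Utau_class u) = Utau_class (a *: u).
Proof. by apply/Utau_classP; rewrite -scalerBr; apply/left_idealZ/Utau_reprP. Qed.

Lemma Utau_ind (P : Utau -> Prop) : (forall u, P (Utau_class u)) -> forall x, P x.
Proof. by move=> h x; rewrite -[x]reprK; apply: h. Qed.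

Let qE := (Utau_addE, Utau_oppE, Utau_scaleE).

Let qaddA : associative Utau_add.
Proof. by do 3!elim/Utau_ind=> ?; rewrite !qE addrA. Qed.
Let qaddC : commutative Utau_add.
Proof. by do 2!elim/Utau_ind=> ?; rewrite !qE addrC. Qed.
Let qadd0 : left_id (Utau_class 0) Utau_add.
Proof. by elim/Utau_ind=> ?; rewrite !qE add0r. Qed.
Let qaddN : left_inverse (Utau_class 0) Utau_opp Utau_add.
Proof. by elim/Utau_ind=> ?; rewrite !qE addNr. Qed.

HB.instance Definition _ := GRing.isZmodule.Build Utau qaddA qaddC qadd0 qaddN.

Let qscaleA a b t : Utau_scale a (Utau_scale b t) = Utau_scale (a * b) t.
Proof. by elim/Utau_ind: t => ?; rewrite !qE scalerA. Qed.
Let qscale1 : left_id 1 Utau_scale.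
Proof. by elim/Utau_ind=> ?; rewrite !qE scale1r. Qed.
Let qscaleDr : right_distributive Utau_scale +%R.
Proof.
move=> a; do 2!elim/Utau_ind=> ?.
by rewrite -![_ + _]/(Utau_add _ _) !qE scalerDr.
Qed.
Let qscaleDl t : {morph Utau_scale^~ t : a b / a + b}.
Proof.
elim/Utau_ind: t => u a b.
by rewrite -![RHS]/(Utau_add _ _) !qE scalerDl.
Qed.

HB.instance Definition _ :=
  GRing.Zmodule_isLmodule.Build k Utau qscaleA qscale1 qscaleDr qscaleDl.

Lemma Utau_class_linear : linear Utau_class.
Proof.
move=> a u v; rewrite -[RHS]/(Utau_add (Utau_scale _ _) _).
by rewrite !qE.
Qed.
HB.instance Definition _ :=
  GRing.isLinear.Build k (uea g) Utau *:%R Utau_class Utau_class_linear.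

Lemma Utau_class_ideal u : left_ideal u -> Utau_class u = 0.
Proof. by move=> hu; apply/Utau_classP; rewrite subr0. Qed.

Definition Utau_one : Utau := Utau_class 1.

(* The coalgebra structure induced from U(g): see Utau_comulE, Utau_counitE.  *)
Definition Utau_comul (x : Utau) : tensor Utau Utau :=
  tmap Utau_class Utau_class (uea_comul (repr x)).
Definition Utau_counit (x : Utau) : k := uea_counit (repr x).

Lemma coideal_comul u : left_ideal u ->
  tmap Utau_class Utau_class (uea_comul u) = 0.
Proof.
move=> [l [hl ->]]; rewrite (linear_sum (@uea_comul k g)) linear_sum.
rewrite big1_seq // => -[w x] /andP[_ /hl /= xs].
have wx0 v : Utau_class (v * uea_inj x) = 0.
  apply: Utau_class_ideal; exists [:: (v, x)]; split; last by rewrite big_seq1.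
  by move=> p; rewrite inE => /eqP->.
rewrite rmorphM /= uea_comul_inj.
elim/tensor_ind: (uea_comul w) => [|p q hp hq|a b].
- by rewrite mul0r linear0.
- by rewrite mulrDl linearD /= hp hq addr0.
- rewrite mulrDr !uea_tensorM linearD /= !tmapE /= !wx0.
  by rewrite linear0l linear0r addr0.
Qed.

Lemma coideal_counit u : left_ideal u -> uea_counit u = 0.
Proof.
move=> [l [hl ->]]; rewrite linear_sum big1 // => p _.
by rewrite rmorphM /= uea_counit_inj mulr0.
Qed.

Lemma Utau_comulE u :
  Utau_comul (Utau_class u) = tmap Utau_class Utau_class (uea_comul u).
Proof.
apply/eqP; rewrite -subr_eq0 -!linearB /=.
by rewrite coideal_comul //; apply: Utau_reprP.
Qed.

Lemma Utau_counitE u : Utau_counit (Utau_class u) = uea_counit u.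
Proof.
apply/eqP; rewrite -subr_eq0 -linearB /=.
by rewrite coideal_counit //; apply: Utau_reprP.
Qed.

Lemma Utau_comul_linear : linear Utau_comul.
Proof.
move=> a; do 2!elim/Utau_ind=> ?.
by rewrite -linearP !Utau_comulE !linearP.
Qed.
HB.instance Definition _ :=
  GRing.isLinear.Build k Utau (tensor Utau Utau) *:%R Utau_comul
    Utau_comul_linear.

Lemma Utau_counit_linear : linear_for *%R Utau_counit.
Proof.
move=> a; do 2!elim/Utau_ind=> ?.
by rewrite -linearP !Utau_counitE !linearP.
Qed.
HB.instance Definition _ :=
  GRing.isLinear.Build k Utau k *%R Utau_counit Utau_counit_linear.

(* For a triple (g, s, c) in characteristic 0 the symmetrized classes span    *)
(* Utau, so that at most one bilinear map satisfies this formula; by the      *)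
(* Poincare-Birkhoff-Witt theorem there is one.                               *)
Definition is_Utau_product (mul : {bilinear Utau -> Utau -> Utau}) : Prop :=
  forall (u : uea g) (n : nat) (x : 'I_n -> g), (forall i, x i \in c) ->
    mul (Utau_class u)
        (\sum_(sigma : 'S_n)
            Utau_class (\prod_(i < n) uea_inj (x (sigma i)))) =
    \sum_(sigma : 'S_n)
       Utau_class ((\prod_(i < n) uea_inj (x (sigma (rev_ord i)))) * u).

End Triple.

(* Main.v *)
From HB Require Import structures.
Require Import Defs.
From mathcomp Require Import all_boot perm all_algebra.
From mathcomp Require Import boolp classical_sets.
Set Implicit Arguments.
Unset Strict Implicit.
Unset Printing Implicit Defensive.
Import GRing.Theory.
Local Open Scope ring_scope.

(** Think of [U(g)] as the group algebra of a group [G], of [Utau] as the coset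
space [G / S] with base point [o], and of an element of [Utau] as represented in
[exp c]. The product is then [x * y = y x], the coset of [y x], with [y] in [exp c].
For [u] and [v] in [exp c] let [w] in [exp c] represent [v u o] and put
[h = w^-1 v u]. This [h] fixes [o], and [r (u, v)] is the action of [h]. As
[g = N + c], where [N] is the normalizer of [c], there is a factorization
[h = t^-1 n] with [t] in [exp c] and [n] in the group of [N]. Choose [t] for the
hypospecial operation on [u] and [v]. Then [H (u, v)] is the action of [t h = n]. Since
[n y n^-1] is in [exp c], [n y x = (n y n^-1) (n x)] is the product of [n x] by
[n y n^-1], and the class of [n y n^-1] is [t \ (n y)] because
[n y n^-1 t o = n y n^-1 (t h) o = n y o]. This is the hypospecial identity.

Group elements are replaced by group-like power series in a parameter [s], called
curves: sequences [p] such that the comultiplication of [p n] is the sum of the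
[p i (x) p (n - i)]. The series [exp (s x)] span [U(g)], their classes for [x] in
[c] span [Utau], and Cauchy products of these span [Utau (x) Utau]. On a curve a
Sweedler sum is a Cauchy product, so that identities between linear maps reduce to
group identities for power series ([tlift_curve], [eq_on_curves]).

The difficulty is to define linear maps on [U(g)] and [Utau] from their values on
exponentials. The Poincare-Birkhoff-Witt theorem is avoided: the map
[z |-> z_(1) z_(2)] exists on both, and multiplies the coefficient of degree [n] of an
exponential series by [2 ^ n]. Its eigenspaces give a grading ([degree_one]), and
every linear map out of degree one extends by a convolution exponential
([exp_lift]). This yields the antipode, the representative in [exp c] of an element
of [Utau] ([sym_section]), and, after inverting the unipotent map that sends
[exp (s (b + a))] to [exp (s b) exp (s a)], the factorization of a group element into
its parts [t] and [n] ([normalizer_factorization]). Left division comes from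
inverting another unipotent map ([left_division]), and right division by [v] is
the action of the inverse of the representative of [v]. *)

(** * Linear maps and subspaces *)

Notation bilin f := (bilinear_for *:%R *:%R f).

Section LinearTools.
Variable k : fieldType.
Implicit Types U V W X : lmodType k.

Definition subspace V (P : V -> Prop) : Prop :=
  P 0 /\ forall a x y, P x -> P y -> P (a *: x + y).

Definition span V (S : V -> Prop) (v : V) : Prop :=
  forall P, subspace P -> (forall x, S x -> P x) -> P v.

Section Subspace.
Variables (V : lmodType k) (P : V -> Prop) (hP : subspace P).

Lemma subspace0 : P 0. Proof. exact: hP.1. Qed.

Lemma subspaceD x y : P x -> P y -> P (x + y).
Proof. by move=> hx hy; rewrite -[x]scale1r; apply: hP.2. Qed.

Lemma subspaceZ a x : P x -> P (a *: x).
Proof. by move=> hx; rewrite -[_ *: _]addr0; apply: hP.2 => //; apply: hP.1. Qed.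

Lemma subspaceN x : P x -> P (- x).
Proof. by move=> hx; rewrite -scaleN1r; apply: subspaceZ. Qed.

Lemma subspaceB x y : P x -> P y -> P (x - y).
Proof. by move=> hx hy; apply: subspaceD => //; apply: subspaceN. Qed.

Lemma subspace_sum I (r : seq I) (F : I -> V) :
  (forall i, P (F i)) -> P (\sum_(i <- r) F i).
Proof. by move=> h; elim/big_ind: _ => //; [exact: subspace0|exact: subspaceD]. Qed.
End Subspace.

Lemma span_gen V (S : V -> Prop) x : S x -> span S x.
Proof. by move=> Sx P _; apply. Qed.

Lemma span_subspace V (S : V -> Prop) : subspace (span S).
Proof.
split=> [P [? _] _ //|a x y hx hy P hP hS].
by apply: hP.2; [exact: hx P hP hS|exact: hy P hP hS].
Qed.

Lemma span_sub V (S T : V -> Prop) v :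
  (forall x, S x -> span T x) -> span S v -> span T v.
Proof. by move=> h hv; exact: (hv (span T) (span_subspace T) h). Qed.

Lemma linear_at0 V W (f : V -> W) : linear f -> f 0 = 0.
Proof. by move=> hf; have := hf (-1) 0 0; rewrite scaler0 addr0 scaleN1r addNr. Qed.

Lemma linear_atZ V W (f : V -> W) c x : linear f -> f (c *: x) = c *: f x.
Proof. by move=> hf; rewrite -[c *: x]addr0 hf linear_at0 // addr0. Qed.

Lemma linear_atD V W (f : V -> W) x y : linear f -> f (x + y) = f x + f y.
Proof. by move=> hf; rewrite -[x in LHS]scale1r hf scale1r. Qed.

Lemma subspace_eq V W (f g : V -> W) :
  linear f -> linear g -> subspace (fun x => f x = g x).
Proof.
move=> hf hg; split=> [|a x y ex ey]; last by rewrite hf hg ex ey.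
by rewrite !linear_at0.
Qed.

Lemma eq_on_span V W (S : V -> Prop) (f g : V -> W) :
  linear f -> linear g -> (forall x, S x -> f x = g x) ->
  forall v, span S v -> f v = g v.
Proof. by move=> hf hg h v hv; exact: (hv (fun x => f x = g x) (subspace_eq hf hg) h). Qed.

Lemma subspace_preim V W (f : V -> W) (P : W -> Prop) :
  linear f -> subspace P -> subspace (fun x => P (f x)).
Proof.
move=> hf hP; split=> [|a x y hx hy]; last by rewrite hf; apply: hP.2.
by rewrite linear_at0 //; apply: hP.1.
Qed.

Lemma subspace_mem V (S : {pred V}) : submod_closed S -> subspace (fun x => x \in S).
Proof. by case=> S0 SD; split=> // a x y; apply: SD. Qed.

Lemma lin_id V : linear (fun x : V => x). Proof. by []. Qed.

Lemma lin0 V W : linear (fun _ : V => 0 : W).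
Proof. by move=> a x y; rewrite scaler0 addr0. Qed.

Lemma lin_comp U V W (f : V -> W) (h : U -> V) :
  linear f -> linear h -> linear (fun x => f (h x)).
Proof. by move=> hf hh a x y; rewrite hh hf. Qed.

Lemma lin_scale V W (f : V -> W) c : linear f -> linear (fun x => c *: f x).
Proof. by move=> hf a x y; rewrite hf scalerDr !scalerA mulrC. Qed.

Lemma lin_sub V W (f h : V -> W) :
  linear f -> linear h -> linear (fun x => f x - h x).
Proof.
move=> hf hh a x y; rewrite hf hh scalerBr opprD -!addrA; congr (_ + _).
by rewrite addrCA.
Qed.

Lemma lin_sum V W I (r : seq I) (f : I -> V -> W) :
  (forall i, linear (f i)) -> linear (fun x => \sum_(i <- r) f i x).
Proof.
move=> hf a x y; rewrite scaler_sumr -big_split; apply: eq_bigr => i _; exact: hf.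
Qed.

Lemma lin_scalar V W (f : V -> k) (w : W) :
  linear_for *%R f -> linear (fun x => f x *: w).
Proof. by move=> hf a x y; rewrite hf scalerDl scalerA. Qed.

Definition mklin V W (f : V -> W) (hf : linear f) : {linear V -> W} :=
  HB.pack f (GRing.isLinear.Build k V W *:%R f hf).

Definition mkbilin U V W (f : U -> V -> W) (hf : bilin f) : {bilinear U -> V -> W} :=
  HB.pack f (bilinear_isBilinear.Build k U V W *:%R *:%R f hf).

Lemma bilinP U V W (f : {bilinear U -> V -> W}) : bilin f.
Proof. by split=> [v|u] a x y; rewrite ?linearPl ?linearPr. Qed.

Lemma tlift_lin U V W (f : U -> V -> W) : bilin f -> linear (tlift f).
Proof. by move=> hf; apply: (tlift_is_linear (mkbilin hf)). Qed.

Lemma tlift_pure U V W (f : U -> V -> W) u v : bilin f -> tlift f (u \ot v) = f u v.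
Proof. by move=> hf; apply: (tliftE (mkbilin hf)). Qed.


Lemma lin_tlift (X U V W : lmodType k) (F : X -> U -> V -> W) t :
  (forall u v, linear (fun x => F x u v)) -> linear (fun x => tlift (F x) t).
Proof. by move=> h; apply: lin_sum => p; apply: h. Qed.

Lemma tlift_ext U V W (F G : U -> V -> W) t :
  (forall u v, F u v = G u v) -> tlift F t = tlift G t.
Proof. by move=> h; apply: eq_bigr => p _; apply: h. Qed.

Lemma lin_tlift_comp U V W X (F : V -> W -> X) (D : U -> tensor V W) :
  bilin F -> linear D -> linear (fun x => tlift F (D x)).
Proof. by move=> hF hD; apply: lin_comp hD; apply: tlift_lin. Qed.

Lemma linear_comp_tlift U V W X (f : W -> X) (F : U -> V -> W) t :
  linear f -> f (tlift F t) = \sw_(a, b <- t) f (F a b).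
Proof. by move=> hf; rewrite /tlift /tsum -[f]/(mklin hf : _ -> _) linear_sum. Qed.

End LinearTools.

(** * Constructing linear maps *)

Section Constructions.
Variable k : fieldType.
Implicit Types U V W : lmodType k.

Section Vandermonde.
Hypothesis char0 : [pchar k] =i pred0.

Lemma pow2_inj i j : (2 ^ i)%:R = (2 ^ j)%:R :> k -> i = j.
Proof.
wlog le_ij : i j / (i <= j)%N => [hw e|].
  by case/orP: (leq_total i j) => h; [apply: hw|apply/esym/hw].
move=> e; have /eqP : (2 ^ j - 2 ^ i)%:R = 0 :> k.
  by rewrite natrB ?leq_exp2l // e subrr.
rewrite ((pcharf0P k).1 char0) subn_eq0 leq_exp2l // => le_ji.
by apply/eqP; rewrite eqn_leq le_ij.
Qed.

(** Vandermonde, without matrices: [p (2 x) - 2 ^ N p x] kills the top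
coefficient and multiplies each lower one by a nonzero scalar. *)
Lemma subspace_coef V (P : V -> Prop) (v : nat -> V) N : subspace P ->
  (forall m, P (\sum_(j < N) (2 ^ (m * j))%:R *: v j)) ->
  forall j, (j < N)%N -> P (v j).
Proof.
move=> hP; elim: N v => // N IH v hv.
have low : forall j, (j < N)%N -> P (v j).
  move=> j ltjN; pose w j := ((2 ^ j)%:R - (2 ^ N)%:R) *: v j.
  have /(_ j ltjN) : forall j, (j < N)%N -> P (w j).
    apply: IH => m; set s := (X in P X).
    have -> : s = \sum_(j < N.+1) (2 ^ (m.+1 * j))%:R *: v j
                  - (2 ^ N)%:R *: \sum_(j < N.+1) (2 ^ (m * j))%:R *: v j.
      rewrite scaler_sumr -sumrB big_ord_recr /= scalerA -natrM -expnD.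
      rewrite (mulnDl 1 m N) mul1n subrr addr0; apply: eq_bigr => i _.
      rewrite /w !scalerA -scalerBl mulrBr -!natrM -!expnD.
      by rewrite (mulnDl 1 m i) mul1n addnC [(N + _)%N]addnC.
    by apply: subspaceB => //; apply: subspaceZ.
  rewrite /w => /(subspaceZ hP ((2 ^ j)%:R - (2 ^ N)%:R)^-1).
  rewrite scalerA mulVf ?scale1r // subr_eq0.
  by apply/eqP => /pow2_inj e; rewrite e ltnn in ltjN.
move=> j; rewrite ltnS leq_eqVlt => /predU1P[->|]; last exact: low.
have := hv 0%N; rewrite big_ord_recr /= mul0n scale1r => h.
rewrite -[v N](addKr (\sum_(i < N) (2 ^ (0 * i))%:R *: v i)) addrC.
apply: subspaceB => //.
by apply: (subspace_sum hP) => i; apply/(subspaceZ hP)/low.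
Qed.
End Vandermonde.

(** The vector-space form of the axiom of choice: extend a maximal functional
linear relation contained in [R]. *)
Lemma linear_selection V W (R : V -> W -> Prop) :
  (forall v, exists w, R v w) ->
  (forall a v w v' w', R v w -> R v' w' -> R (a *: v + v') (a *: w + w')) ->
  exists f : {linear V -> W}, forall v, R v (f v).
Proof.
move=> tot lin.
(* Graphs of partial linear selections. The empty one is included, so that the
   empty chain has an upper bound; [E0] below adjoins the origin to the maximal one. *)
pose good (X : set (V * W)) :=
  [/\ forall p, X p -> R p.1 p.2,
      forall a p q, X p -> X q -> X (a *: p.1 + q.1, a *: p.2 + q.2)
    & forall p q, X p -> X q -> p.1 = q.1 -> p.2 = q.2].
have R00 : R 0 0.
  by have [w Rw] := tot 0; have := lin (-1) _ _ _ _ Rw Rw;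
     rewrite !scaleN1r !addNr.
have [F Fgood Ftot|E [[ER Elin Efun] Emax]] := @Zorn_bigcup _ good.
  have common p q X Y : F X -> F Y -> X p -> Y q ->
      exists Z, [/\ F Z, Z p & Z q].
    move=> FX FY Xp Yq; case: (Ftot X Y FX FY) => sXY.
      by exists Y; split=> //; apply: sXY.
    by exists X; split=> //; apply: sXY.
  split=> [p [X FX Xp]|a p q [X FX Xp] [Y FY Yq]|p q [X FX Xp] [Y FY Yq]].
  - by have [h _ _] := Fgood X FX; apply: h.
  - have [Z [FZ Zp Zq]] := common p q X Y FX FY Xp Yq.
    by exists Z => //; have [_ h _] := Fgood Z FZ; apply: h.
  - have [Z [FZ Zp Zq]] := common p q X Y FX FY Xp Yq.
    by have [_ _ h] := Fgood Z FZ; apply: h.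
pose E0 : set (V * W) := fun p => E p \/ p = (0, 0).
have E0lin a p q : E0 p -> E0 q -> E0 (a *: p.1 + q.1, a *: p.2 + q.2).
  case=> [Ep|->] [Eq|->] /=.
  - by left; apply: Elin.
  - rewrite !addr0; left; have := Elin (a - 1) _ _ Ep Ep.
    by rewrite !scalerBl !scale1r !subrK.
  - by rewrite !scaler0 !add0r -surjective_pairing; left.
  - by rewrite !scaler0 !addr0; right.
have E00 p : E p -> p.1 = 0 -> p.2 = 0.
  move=> Ep p0; have Epp := Elin 1 _ _ Ep Ep.
  have := Efun _ _ Epp Ep; rewrite /= p0 scaler0 addr0 scale1r => /(_ erefl).
  by move/eqP; rewrite -subr_eq0 addrK => /eqP.
have dom v : exists w, E0 (v, w).
  apply: contrapT => hv; have [w Rvw] := tot v.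
  have scal a v' w' : E0 (a *: v, w') -> E0 (v', w') -> a = 0.
    move=> h _; apply: contrapT => /eqP a0; apply: hv; exists (a^-1 *: w').
    have := E0lin a^-1 _ _ h (or_intror erefl : E0 (0, 0)).
    by rewrite /= scalerA mulVf // scale1r !addr0.
  (* The extension of [E0] to the line through [v]. *)
  pose X : set (V * W) := fun p => exists a q, E0 q /\
     p = (a *: v + q.1, a *: w + q.2).
  apply: (Emax X); last first.
    split.
    - move=> p [a [q [E0q ->]]] /=; apply: lin => //.
      by case: E0q => [/ER //|->].
    - move=> a p q [b [p' [E0p ->]]] [c [q' [E0q ->]]] /=.
      exists (a * b + c), (a *: p'.1 + q'.1, a *: p'.2 + q'.2).
      split; first exact: E0lin.
      have comb (Z : lmodType k) (z p1 q1 : Z) :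
          a *: (b *: z + p1) + (c *: z + q1) = (a * b + c) *: z + (a *: p1 + q1).
        by rewrite scalerDr scalerDl scalerA addrACA.
      by rewrite /= !comb.
    - move=> p q [b [p' [E0p ->]]] [c [q' [E0q ->]]] /= e.
      have h : E0 ((b - c) *: v, q'.2 - p'.2).
        have := E0lin (-1) _ _ E0p E0q; rewrite !scaleN1r.
        have -> : - p'.1 + q'.1 = (b - c) *: v.
          have -> : q'.1 = b *: v + p'.1 - c *: v by rewrite e addrAC subrr add0r.
          by rewrite scalerBl addrC addrAC addrK.
        by rewrite [- _ + _]addrC.
      have bc : b = c.
        by apply/eqP; rewrite -subr_eq0; apply/eqP/(scal _ _ _ h h).
      rewrite bc; congr (_ + _); move: h; rewrite bc subrr scale0r.
      case=> [/E00 /(_ erefl) /= /eqP|[/eqP]]; by rewrite subr_eq0 => /eqP->.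
  split=> [p Ep|hX].
    by exists 0, p; split; [left|rewrite !scale0r !add0r -surjective_pairing].
  apply: hv; exists w; left; apply: hX; exists 1, (0, 0); split; first by right.
  by rewrite /= !scale1r !addr0.
have [f Ef] := choice dom.
have E0fun p q : E0 p -> E0 q -> p.1 = q.1 -> p.2 = q.2.
  move=> [Ep|->] [Eq|->] //=; first exact: Efun.
    exact: E00.
  by move=> e; rewrite E00.
have flin : linear f.
  by move=> a x y; apply: (E0fun _ _ (Ef _) (E0lin a _ _ (Ef x) (Ef y))).
exists (mklin flin) => v /=.
by case: (Ef v) => [/ER //|[-> ->]].
Qed.

(** Infinite sums and products of operators are evaluated with this lemma: each
vector is affected by finitely many of their factors. *)
Lemma linear_limit V W (p : nat -> V -> W) (S : V -> Prop) :
  (forall n, linear (p n)) -> (forall v, span S v) ->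
  (forall v, S v -> exists w N, forall M, (N <= M)%N -> p M v = w) ->
  exists f : {linear V -> W},
    forall v w N, (forall M, (N <= M)%N -> p M v = w) -> f v = w.
Proof.
move=> plin spS ev.
pose lim v w := exists N, forall M, (N <= M)%N -> p M v = w.
have limD a v v' w w' : lim v w -> lim v' w' -> lim (a *: v + v') (a *: w + w').
  move=> [N hN] [N' hN']; exists (maxn N N') => M; rewrite geq_max => /andP[h h'].
  by rewrite plin hN ?hN'.
have tot v : exists w, lim v w.
  refine (spS v (fun v => exists w, lim v w) _ ev).
  split=> [|a x y [w hw] [w' hw']]; last by exists (a *: w + w'); apply: limD.
  by exists 0, 0%N => M _; rewrite linear_at0.
have uniq v w w' : lim v w -> lim v w' -> w = w'.
  move=> [N hN] [N' hN'].
  by rewrite -(hN (maxn N N')) ?leq_maxl // hN' ?leq_maxr.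
have [f hf] := choice tot.
have flin : linear f by move=> a x y; apply: (uniq _ _ _ (hf _)); apply: limD.
by exists (mklin flin) => v w N h /=; apply: (uniq _ _ _ (hf v)); exists N.
Qed.

(** The inverse of [1 - T] is the geometric series in [T]. *)
Lemma loc_nilpotent_inv V (T : V -> V) (S : V -> Prop) :
  linear T -> (forall v, span S v) ->
  (forall v, S v -> exists n, iter n T v = 0) ->
  exists G : {linear V -> V},
    (forall v, G (v - T v) = v) /\ (forall v, G v - T (G v) = v).
Proof.
move=> Tlin spS nilS.
have itlin n : linear (iter n T).
  by elim: n => [|n IH] a x y //=; rewrite IH Tlin.
have iter0 n : iter n T 0 = 0 by apply: linear_at0.
have nil v : exists n, iter n T v = 0.
  refine (spS v (fun v => exists n, iter n T v = 0) _ nilS).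
  split=> [|a x y [n hn] [m hm]]; first by exists 0%N.
  exists (n + m)%N; rewrite itlin {1}addnC !iterD hn hm.
  by rewrite !iter0 scaler0 addr0.
pose p M v := \sum_(j < M) iter j T v.
have plin M : linear (p M) by apply: lin_sum => j; apply: itlin.
have ev v n : iter n T v = 0 -> forall M, (n <= M)%N -> p M v = p n v.
  move=> hn M /subnKC <-; elim: (M - n)%N => [|d IH]; first by rewrite addn0.
  by rewrite addnS /p big_ord_recr /= -/(p _ v) IH addnC iterD hn iter0 addr0.
have [|G hG] := linear_limit plin spS.
  by move=> v /nilS[n hn]; exists (p n v), n; apply: ev.
have Gp v n : iter n T v = 0 -> G v = p n v by move=> h; apply: hG; apply: ev h.
have tele n v : iter n T v = 0 -> p n v - p n (T v) = v.
  move=> hn; have : p n.+1 v = v + p n (T v).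
    by rewrite /p big_ord_recl; congr (_ + _); apply: eq_bigr => i _; rewrite /= -iterSr.
  by rewrite (ev v n) // => ->; rewrite addrK.
exists G; split=> v; have [n hn] := nil v.
  have hT : iter n T (T v) = 0 by rewrite -iterSr iterS hn linear_at0.
  by rewrite linearB /= (Gp v n) // (Gp (T v) n) // tele.
rewrite (Gp _ n) // [T _](_ : _ = p n (T v)) ?tele //.
rewrite -[T]/(mklin Tlin : _ -> _) linear_sum; apply: eq_bigr => i _.
by rewrite /= -iterS iterSr.
Qed.

End Constructions.

(** * Cauchy products *)

Section TriangleSums.
Variable V : nmodType.

Lemma sum_triangle n (F : nat -> nat -> V) :
  \sum_(i < n.+1) \sum_(j < (n - i).+1) F i j =
  \sum_(j < n.+1) \sum_(i < (n - j).+1) F i j.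
Proof.
transitivity (\sum_(i < n.+1) \sum_(j < n.+1 | (j <= n - i)%N) F i j).
  apply: eq_bigr => i _.
  by rewrite (big_ord_narrow_leq (leq_subr i n)); apply: eq_bigr.
rewrite (exchange_big_dep predT) //=; apply: eq_bigr => j _.
transitivity (\sum_(i < n.+1 | (i <= n - j)%N) F i j).
  by apply: eq_bigl => i; rewrite !leq_subRL -1?ltnS // addnC.
by rewrite (big_ord_narrow_leq (leq_subr j n)); apply: eq_bigr.
Qed.

Lemma sum_assoc n (F : nat -> nat -> nat -> V) :
  \sum_(i < n.+1) \sum_(j < i.+1) F j (i - j)%N (n - i)%N =
  \sum_(i < n.+1) \sum_(j < (n - i).+1) F i j (n - i - j)%N.
Proof.
pose G i j := F j (n - i - j)%N i.
transitivity (\sum_(i < n.+1) \sum_(j < (n - i).+1) G i j).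
  rewrite (reindex_inj rev_ord_inj); apply: eq_bigr => i _ /=.
  by rewrite subSS; apply: eq_bigr => j _; rewrite /G subKn -1?ltnS.
rewrite sum_triangle; apply: eq_bigr => i _.
rewrite (reindex_inj rev_ord_inj); apply: eq_bigr => j _.
rewrite /G /= subSS; congr (F i _ _).
by rewrite subnAC subKn // -ltnS.
Qed.

Lemma sum_interchange n (F : nat -> nat -> nat -> nat -> V) :
  \sum_(i < n.+1) \sum_(a < i.+1) \sum_(b < (n - i).+1)
     F a (i - a)%N b (n - i - b)%N =
  \sum_(i < n.+1) \sum_(a < i.+1) \sum_(b < (n - i).+1)
     F a b (i - a)%N (n - i - b)%N.
Proof.
rewrite (sum_assoc n (fun a b m => \sum_(c < m.+1) F a b c (m - c)%N)).
rewrite (sum_assoc n (fun a b m => \sum_(c < m.+1) F a c b (m - c)%N)).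
apply: eq_bigr => a _; rewrite (sum_triangle _ (fun b c => F a b c (n - a - b - c)%N)).
by apply: eq_bigr => b _; apply: eq_bigr => c _; congr F; rewrite subnAC.
Qed.
End TriangleSums.

Section Cauchy.
Variable k : fieldType.
Implicit Types T U V W X Y Z : lmodType k.

Definition cauchy (U V : Type) W (f : U -> V -> W) (p : nat -> U) (q : nat -> V)
    (n : nat) : W :=
  \sum_(i < n.+1) f (p i) (q (n - i)%N).

Lemma lin_sumE V W (f : V -> W) I (r : seq I) (F : I -> V) :
  linear f -> f (\sum_(i <- r) F i) = \sum_(i <- r) f (F i).
Proof. by move=> hf; rewrite -[f]/(mklin hf : _ -> _) linear_sum. Qed.

Lemma lin_cauchy (T U : Type) V W (f : V -> W) (g : T -> U -> V) p q n :
  linear f -> f (cauchy g p q n) = cauchy (fun x y => f (g x y)) p q n.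
Proof. exact: lin_sumE. Qed.

Lemma eq_cauchy (U V : Type) W (f f' : U -> V -> W) p p' q q' n :
  (forall x y, f x y = f' x y) -> p =1 p' -> q =1 q' ->
  cauchy f p q n = cauchy f' p' q' n.
Proof. by move=> ef ep eq; apply: eq_bigr => i _; rewrite ef ep eq. Qed.

Lemma cauchyC (U V : Type) W (f : U -> V -> W) p q n :
  cauchy f p q n = cauchy (fun y x => f x y) q p n.
Proof.
rewrite /cauchy (reindex_inj rev_ord_inj); apply: eq_bigr => i _ /=.
by rewrite subSS subKn // -ltnS.
Qed.

Lemma cauchyA (T U X : Type) V W Y (f : V -> X -> Y) (g : T -> U -> V)
    (f' : T -> W -> Y) (g' : U -> X -> W) p q r n :
  (forall z, linear (f^~ z)) -> (forall x, linear (f' x)) ->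
  (forall x y z, f (g x y) z = f' x (g' y z)) ->
  cauchy f (cauchy g p q) r n = cauchy f' p (cauchy g' q r) n.
Proof.
move=> hf hf' e.
transitivity (\sum_(i < n.+1) \sum_(j < i.+1)
   f (g (p j) (q (i - j)%N)) (r (n - i)%N)).
  by apply: eq_bigr => i _; rewrite /cauchy (lin_sumE _ _ (hf _)).
rewrite (sum_assoc n (fun a b c => f (g (p a) (q b)) (r c))).
apply: eq_bigr => i _; rewrite /cauchy (lin_sumE _ _ (hf' _)).
by apply: eq_bigr => j _.
Qed.

Lemma cauchy_deltal (U : Type) V W (f : V -> U -> W) (v : V) (q : nat -> U) n :
  (forall y, linear (f^~ y)) ->
  cauchy f (fun i => (i == 0%N)%:R *: v) q n = f v (q n).
Proof.
move=> fl; have f0 y : f 0 y = 0 by exact: (linear_at0 (fl y)).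
rewrite /cauchy big_ord_recl /= subn0 scale1r big1 ?addr0 // => i _.
by rewrite scale0r.
Qed.

Lemma cauchy_deltar (U : Type) V W (f : U -> V -> W) (v : V) (p : nat -> U) n :
  (forall x, linear (f x)) ->
  cauchy f p (fun i => (i == 0%N)%:R *: v) n = f (p n) v.
Proof. by move=> fr; rewrite cauchyC cauchy_deltal. Qed.
End Cauchy.

(** * Coalgebras spanned by group-like power series *)

Section Curves.
Variable k : fieldType.
Implicit Types U V W X : lmodType k.

Section Defs.
Variables (C : lmodType k) (D : C -> tensor C C) (e : C -> k).

(** The power series [\sum_n (p n) s ^ n] is group-like. *)
Definition curve (p : nat -> C) : Prop :=
  (forall n, D (p n) = cauchy (@tpure k C C) p p n) /\
  (forall n, e (p n) = (n == 0%N)%:R).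

Definition curve_spanned : Prop :=
  forall z, span (fun y => exists p n, curve p /\ y = p n) z.

Definition trilin U V W X (F : U -> V -> W -> X) : Prop :=
  [/\ forall b c, linear (fun a => F a b c), forall a c, linear (fun b => F a b c)
    & forall a b, linear (F a b)].

Lemma tpure_bilin U V : bilin (@tpure k U V).
Proof. exact: tpure_is_bilinear. Qed.

Lemma tlift_cauchy (T T' : Type) U V W (F : U -> V -> W)
    (g : T -> U) (h : T' -> V) p q n :
  bilin F ->
  tlift F (cauchy (fun x y => g x \ot h y) p q n) =
  cauchy (fun x y => F (g x) (h y)) p q n.
Proof.
move=> hF; rewrite (lin_cauchy _ _ _ _ (tlift_lin hF)).
by apply: eq_bigr => i _; rewrite tlift_pure.
Qed.

Lemma tlift_curve W (F : C -> C -> W) p n :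
  bilin F -> curve p -> tlift F (D (p n)) = cauchy F p p n.
Proof. by move=> hF [-> _]; rewrite (tlift_cauchy id id). Qed.
End Defs.

Section Spanned.
Variables (C : lmodType k) (D : {linear C -> tensor C C}) (e : {scalar C}).
Hypothesis spC : curve_spanned D e.

Lemma eq_on_curves W (f h : C -> W) : linear f -> linear h ->
  (forall p n, curve D e p -> f (p n) = h (p n)) -> forall z, f z = h z.
Proof.
move=> hf hh E z; apply: (eq_on_span hf hh _ (spC z)) => _ [p [n [hp ->]]].
exact: E.
Qed.

Lemma sw_cocomm W (F : C -> C -> W) z : bilin F ->
  \sw_(a, b <- D z) F a b = \sw_(a, b <- D z) F b a.
Proof.
move=> hF; have hF' : bilin (fun a b => F b a) by split; [apply: hF.2|apply: hF.1].
move: z; apply: eq_on_curves => [||p n hp].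
- exact: lin_tlift_comp (linearP D).
- exact: lin_tlift_comp (linearP D).
- by rewrite !(tlift_curve _ _ hp) // cauchyC.
Qed.

Lemma sw_coassoc W (F : C -> C -> C -> W) z : trilin F ->
  \sw_(a, b <- D z) \sw_(a1, a2 <- D a) F a1 a2 b =
  \sw_(a, b <- D z) \sw_(b1, b2 <- D b) F a b1 b2.
Proof.
move=> [F1 F2 F3].
have B1 : bilin (fun a b => \sw_(a1, a2 <- D a) F a1 a2 b).
  split=> [b|a]; last by apply: lin_tlift.
  by apply: lin_tlift_comp (linearP D); split.
have B2 : bilin (fun a b => \sw_(b1, b2 <- D b) F a b1 b2).
  split=> [b|a]; first by apply: lin_tlift.
  by apply: lin_tlift_comp (linearP D); split.
move: z; apply: eq_on_curves => [||p n hp].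
- exact: lin_tlift_comp (linearP D).
- exact: lin_tlift_comp (linearP D).
rewrite !(tlift_curve _ _ hp) //.
transitivity (\sum_(i < n.+1) \sum_(j < i.+1)
    F (p j) (p (i - j)%N) (p (n - i)%N)).
  by apply: eq_bigr => i _; rewrite (tlift_curve _ _ hp) //; split.
rewrite (sum_assoc n (fun a b c => F (p a) (p b) (p c))).
by apply: eq_bigr => i _; rewrite (tlift_curve _ _ hp) //; split.
Qed.

Lemma sw_counitl W (f : C -> W) z : linear f ->
  \sw_(a, b <- D z) (e a *: f b) = f z.
Proof.
move=> hf; have B : bilin (fun a b => e a *: f b).
  split=> [b|a]; last exact: lin_scale.
  by apply: lin_scalar => c x y; rewrite linearP.
move: z; apply: eq_on_curves => // [|p n hp]; first exact: lin_tlift_comp (linearP D).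
rewrite (tlift_curve _ _ hp) //.
have := @cauchy_deltal k C k^o W (fun a b => a *: f b) 1 p n.
rewrite scale1r => <- => [|y]; last exact: lin_scalar.
by apply: eq_bigr => i _; rewrite hp.2 [_ *: 1]mulr1.
Qed.

Lemma sw_counitr W (f : C -> W) z : linear f ->
  \sw_(a, b <- D z) (e b *: f a) = f z.
Proof.
move=> hf; rewrite -[RHS](sw_counitl z hf) [RHS]sw_cocomm //.
split=> [b|a]; last exact: lin_scale.
by apply: lin_scalar => c x y; rewrite linearP.
Qed.
End Spanned.

Section Morphisms.
Variables (C C' : lmodType k) (D : {linear C -> tensor C C}) (e : {scalar C}).
Variables (D' : {linear C' -> tensor C' C'}) (e' : {scalar C'}).

(** On coalgebras spanned by curves these are the coalgebra morphisms. *)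
Definition curve_map (f : C -> C') : Prop :=
  forall p, curve D e p -> curve D' e' (f \o p).

Hypothesis spC : curve_spanned D e.
Variable f : C -> C'.
Hypotheses (flin : linear f) (hf : curve_map f).

Lemma sw_map W (F : C' -> C' -> W) z : bilin F ->
  \sw_(a, b <- D' (f z)) F a b = \sw_(a, b <- D z) F (f a) (f b).
Proof.
move=> hF; have hF' : bilin (fun a b => F (f a) (f b)).
  by split=> [b|a]; [exact: (lin_comp (hF.1 _) flin)|exact: (lin_comp (hF.2 _) flin)].
move: z; apply: (eq_on_curves spC) => [||p n hp].
- exact: (lin_comp (lin_tlift_comp hF (linearP D')) flin).
- exact: lin_tlift_comp (linearP D).
- by rewrite (tlift_curve n hF (hf hp)) (tlift_curve _ _ hp).
Qed.

Lemma counit_map z : e' (f z) = e z.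
Proof.
have l1 : linear ((fun x => e' (f x)) : C -> k^o) by move=> a x y; rewrite flin linearP.
have l2 : linear (e : C -> k^o) by move=> a x y; rewrite linearP.
by apply: (eq_on_curves spC l1 l2) => p n hp; rewrite hp.2 (hf hp).2.
Qed.
End Morphisms.

End Curves.

Section Products.
Variables (k : fieldType) (C1 C2 C3 : lmodType k).
Variables (D1 : {linear C1 -> tensor C1 C1}) (e1 : {scalar C1}).
Variables (D2 : {linear C2 -> tensor C2 C2}) (e2 : {scalar C2}).
Variables (D3 : {linear C3 -> tensor C3 C3}) (e3 : {scalar C3}).
Variable m : C1 -> C2 -> C3.
Hypothesis mlin : bilin m.

Let mm_bilin x x' : bilin (fun y y' => m x y \ot m x' y').
Proof.
split=> [y'|y]; first exact: (lin_comp ((tpure_bilin _ _).1 _) (mlin.2 _)).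
exact: (lin_comp ((tpure_bilin _ _).2 _) (mlin.2 _)).
Qed.

Lemma sw_mul_bilinl t : bilin (fun x x' => \sw_(y, y' <- t) (m x y \ot m x' y')).
Proof.
split=> [x'|x]; apply: lin_tlift => y y'.
  exact: (lin_comp ((tpure_bilin _ _).1 _) (mlin.1 _)).
exact: (lin_comp ((tpure_bilin _ _).2 _) (mlin.1 _)).
Qed.

Lemma sw_mul_bilin : bilin (fun s t =>
  \sw_(x, x' <- s) \sw_(y, y' <- t) (m x y \ot m x' y')).
Proof.
split=> [t|s]; first exact: (tlift_lin (sw_mul_bilinl t)).
by apply: lin_tlift => x x'; apply: tlift_lin.
Qed.

Lemma sw_mul_pure x x' y y' :
  \sw_(u, u' <- x \ot x') \sw_(v, v' <- y \ot y') (m u v \ot m u' v') =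
  m x y \ot m x' y'.
Proof. by rewrite tlift_pure; [rewrite tlift_pure|exact: sw_mul_bilinl]. Qed.

Hypothesis D3m : forall x y, D3 (m x y) =
  \sw_(x1, x2 <- D1 x) \sw_(y1, y2 <- D2 y) (m x1 y1 \ot m x2 y2).
Hypothesis e3m : forall x y, e3 (m x y) = e1 x * e2 y.

(** Cocommutativity of power series: [sum_interchange] lets the two middle Sweedler
factors trade places. *)
Lemma curve_cauchy p q :
  curve D1 e1 p -> curve D2 e2 q -> curve D3 e3 (cauchy m p q).
Proof.
move=> hp hq; split=> n.
  transitivity (\sum_(i < n.+1) \sum_(a < i.+1) \sum_(b < (n - i).+1)
      (m (p a) (q b) \ot m (p (i - a)%N) (q (n - i - b)%N))).
    rewrite linear_sum; apply: eq_bigr => i _ /=; rewrite D3m.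
    rewrite (tlift_curve _ (sw_mul_bilinl _) hp); apply: eq_bigr => a _.
    by rewrite (tlift_curve _ _ hq).
  rewrite (sum_interchange n (fun x x' y y' => m (p x) (q y) \ot m (p x') (q y'))).
  apply: eq_bigr => i _; rewrite /cauchy (lin_sumE _ _ ((tpure_bilin _ _).1 _)).
  by apply: eq_bigr => a _; rewrite (lin_sumE _ _ ((tpure_bilin _ _).2 _)).
rewrite linear_sum /= big_ord_recl e3m hp.2 hq.2 subn0 mul1r big1 ?addr0 // => i _.
by rewrite e3m hp.2 mul0r.
Qed.
End Products.

Section TensorSquare.
Variables (k : fieldType) (char0 : [pchar k] =i pred0) (U : lmodType k).
Variables (D : {linear U -> tensor U U}) (e : {scalar U}).

Lemma tensor_comul_pure u v : tensor_comul D (u \ot v) =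
  \sw_(u1, u2 <- D u) \sw_(v1, v2 <- D v) ((u1 \ot v1) \ot (u2 \ot v2)).
Proof.
have [h1 h2] := sw_mul_bilin (tpure_bilin U U).
rewrite /tensor_comul tlift_pure //.
by split=> [y|x]; [exact: (lin_comp (h1 _) (linearP D))|exact: (lin_comp (h2 _) (linearP D))].
Qed.

Lemma tensor_comul_lin : linear (tensor_comul D).
Proof.
have [h1 h2] := sw_mul_bilin (tpure_bilin U U); apply: tlift_lin.
by split=> [y|x]; [exact: (lin_comp (h1 _) (linearP D))|exact: (lin_comp (h2 _) (linearP D))].
Qed.

Let ee_bilin : bilin (fun u v => e u * e v : k^o).
Proof.
split=> [v|u] a x y; rewrite linearP /=; first by rewrite mulrDl -mulrA.
by rewrite mulrDr mulrCA.
Qed.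

Lemma tensor_counit_pure u v : tensor_counit e (u \ot v) = e u * e v.
Proof. by rewrite /tensor_counit tlift_pure. Qed.

Lemma tensor_counit_lin : linear_for *%R (tensor_counit e).
Proof. exact: (tlift_lin ee_bilin). Qed.

Definition tcomul : {linear tensor U U -> tensor (tensor U U) (tensor U U)} :=
  mklin tensor_comul_lin.
Definition tcounit : {scalar (tensor U U)} :=
  HB.pack (tensor_counit e)
    (GRing.isLinear.Build k (tensor U U) k *%R (tensor_counit e) tensor_counit_lin).

Lemma sw_tensor (W : lmodType k) (F : tensor U U -> tensor U U -> W) u v : bilin F ->
  tlift F (tcomul (u \ot v)) =
  \sw_(u1, u2 <- D u) \sw_(v1, v2 <- D v) F (u1 \ot v1) (u2 \ot v2).
Proof.
move=> hF; rewrite /= tensor_comul_pure.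
rewrite (linear_comp_tlift _ _ (tlift_lin hF)); apply: tlift_ext => u1 u2.
rewrite (linear_comp_tlift _ _ (tlift_lin hF)); apply: tlift_ext => v1 v2.
by rewrite tlift_pure.
Qed.

Lemma curve_tensor p q : curve D e p -> curve D e q ->
  curve tcomul tcounit (cauchy (@tpure k U U) p q).
Proof.
apply: curve_cauchy => [|x y|x y]; first exact: tpure_bilin.
  exact: tensor_comul_pure.
exact: tensor_counit_pure.
Qed.

Lemma curve_rescale c p : curve D e p -> curve D e (fun n => c ^+ n *: p n).
Proof.
move=> hp; split=> n; rewrite linearZ /=.
  rewrite hp.1 /cauchy scaler_sumr; apply: eq_bigr => i _.
  by rewrite linearZl_LR /= linearZr_LR /= scalerA -exprD subnKC // -ltnS.
by rewrite hp.2; case: n => [|n]; rewrite ?mulr0 ?mulr1.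
Qed.

Hypothesis spU : curve_spanned D e.

Definition tensor_curve (r : nat -> tensor U U) : Prop :=
  exists p q, [/\ curve D e p, curve D e q & r = cauchy (@tpure k U U) p q].

(** Rescaling one factor separates the bidegrees of [cauchy tpure p q]. *)
Lemma tensor_curve_span z : span (fun y => exists r n, tensor_curve r /\ y = r n) z.
Proof.
set S := fun y => _; have hS := span_subspace S.
elim/tensor_ind: z => [|x y hx hy|u v]; [exact: (subspace0 hS)|exact: (subspaceD hS)|].
have l1 v' : subspace (fun u' => span S (u' \ot v')).
  exact: (subspace_preim ((tpure_bilin U U).1 _) hS).
have l2 u' : subspace (fun v' => span S (u' \ot v')).
  exact: (subspace_preim ((tpure_bilin U U).2 _) hS).
apply: (spU u (l1 v)) => _ [p [i [hp ->]]].
apply: (spU v (l2 (p i))) => _ [q [j [hq ->]]].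
pose w l := p l \ot q (i + j - l)%N.
have -> : p i \ot q j = w i by rewrite /w addKn.
apply: (@subspace_coef k char0 _ _ w (i + j).+1 hS); last by rewrite ltnS leq_addr.
move=> m; apply: span_gen.
exists (cauchy (@tpure k U U) (fun l => (2 ^ m)%:R ^+ l *: p l) q), (i + j)%N.
split.
  exists (fun l => (2 ^ m)%:R ^+ l *: p l), q; split=> //; exact: curve_rescale.
by apply: eq_bigr => l _; rewrite /w linearZl_LR -natrX -expnM.
Qed.
End TensorSquare.

(** * Graded coalgebras of divided powers *)

Section Lift.
Variables (k : fieldType) (char0 : [pchar k] =i pred0) (C : lmodType k).
Variables (D : {linear C -> tensor C C}) (e : {scalar C}) (G : (nat -> C) -> Prop).
Hypothesis Gcurve : forall p, G p -> curve D e p.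
Hypothesis spG : forall z, span (fun y => exists p n, G p /\ y = p n) z.

Lemma G_curve_spanned : curve_spanned D e.
Proof.
move=> z; apply: span_sub (spG z) => y [p [n [/Gcurve hp ->]]].
by apply: span_gen; exists p, n.
Qed.

(** Compatibility with comultiplication is linear, hence may be tested on [G], and
then makes every curve go to a curve. *)
Lemma curve_map_gen (C' : lmodType k) (D' : {linear C' -> tensor C' C'})
    (e' : {scalar C'}) (f : C -> C') : linear f ->
  (forall p, G p -> curve D' e' (f \o p)) -> curve_map D e D' e' f.
Proof.
move=> flin hf; have B : bilin (fun a b => f a \ot f b).
  split=> [b|a]; first exact: (lin_comp ((tpure_bilin _ _).1 _) flin).
  exact: (lin_comp ((tpure_bilin _ _).2 _) flin).
have eD z : D' (f z) = \sw_(a, b <- D z) (f a \ot f b).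
  apply: (eq_on_span (lin_comp (linearP D') flin) (lin_tlift_comp B (linearP D)) _ (spG z)).
  by move=> _ [p [n [hp ->]]]; rewrite (hf p hp).1 (tlift_curve _ _ (Gcurve hp)).
have ee z : e' (f z) = e z.
  have l1 : linear ((fun x => e' (f x)) : C -> k^o) by move=> a x y; rewrite flin linearP.
  have l2 : linear (e : C -> k^o) by move=> a x y; rewrite linearP.
  apply: (eq_on_span l1 l2 _ (spG z)).
  by move=> _ [p [n [hp ->]]]; rewrite (hf p hp).2 (Gcurve hp).2.
move=> p hp; split=> n /=; last by rewrite ee hp.2.
by rewrite eD (tlift_curve _ _ hp).
Qed.

(** The eigenvalues [2 ^ n] of [psi] are distinct, so that [psi] splits the degrees;
the projection is the limit of its Lagrange interpolation polynomials. *)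
Lemma degree_one (psi : {linear C -> C}) :
  (forall p n, G p -> psi (p n) = (2 ^ n)%:R *: p n) ->
  exists pr : {linear C -> C}, forall p n, G p -> pr (p n) = (n == 1%N)%:R *: p 1%N.
Proof.
move=> psiE; pose d n : k := (2 ^ n)%:R.
(* The factor of the interpolation polynomial that kills degree [M]. *)
pose step (M : nat) (z : C) : C := if M == 1%N then z else (d 1%N - d M)^-1 *: (psi z - d M *: z).
pose fix approx (M : nat) (z : C) {struct M} : C := if M is M'.+1 then step M' (approx M' z) else z.
have step_lin M : linear (step M).
  rewrite /step; case: eqP => // _; apply/lin_scale/lin_sub; first exact: linearP.
  exact/lin_scale/lin_id.
have approx_lin M : linear (approx M).
  by elim: M => [|M IH] //; apply: (lin_comp (step_lin M) IH).
have approx1 p M : G p -> approx M (p 1%N) = p 1%N.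
  move=> hp; elim: M => //= M ->; rewrite /step; case: eqP => // /eqP nM1.
  rewrite psiE // -scalerBl scalerA mulVf ?scale1r // subr_eq0.
  by apply/eqP => /(pow2_inj char0) e1; rewrite -e1 in nM1.
have approx_eigen p M n : G p -> exists c, approx M (p n) = c *: p n.
  move=> hp; elim: M => [|M [c IH]] /=; first by exists 1; rewrite scale1r.
  rewrite IH /step; case: eqP => _; first by exists c.
  rewrite linearZ /= psiE // !scalerA -scalerBl scalerA.
  by eexists.
have approx0 p n M : G p -> n != 1%N -> (n < M)%N -> approx M (p n) = 0.
  move=> hp n1; elim: M => // M IH; rewrite ltnS leq_eqVlt => /predU1P[<-|/IH] /=.
    have [c ->] := approx_eigen p n n hp.
    rewrite /step (negPf n1) linearZ /= psiE // !scalerA -scalerBl.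
    by rewrite [c * _]mulrC subrr scale0r scaler0.
  by move=> ->; apply: linear_at0.
have ev v : (exists p n, G p /\ v = p n) ->
    exists w N, forall M, (N <= M)%N -> approx M v = w.
  move=> [p [n [hp ->]]]; have [->|n1] := eqVneq n 1%N.
    by exists (p 1%N), 0%N => M _; apply: approx1.
  by exists 0, n.+1 => M; apply: approx0.
have [pr hpr] := linear_limit approx_lin spG ev.
exists pr => p n hp; have [->|n1] := eqVneq n 1%N.
  by rewrite scale1r; apply: (hpr _ _ 0%N) => M _; apply: approx1.
by rewrite scale0r; apply: (hpr _ _ n.+1) => M; apply: approx0.
Qed.

Variable pr : {linear C -> C}.
Hypothesis prE : forall p n, G p -> pr (p n) = (n == 1%N)%:R *: p 1%N.

(** The convolution exponential of [q \o pr]: on the coefficient of degree [n] of a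
curve of [G] only the [n]-th convolution power is nonzero. *)
Lemma exp_lift (B : algType k) (q : {linear C -> B}) :
  exists F : {linear C -> B},
    forall p n, G p -> F (p n) = (n`!%:R)^-1 *: q (p 1%N) ^+ n.
Proof.
pose fix pow (n : nat) (z : C) {struct n} : B :=
  if n is n'.+1 then \sw_(a, b <- D z) (q (pr a) * pow n' b) else (e z)%:A.
have pow_bilin n : linear (pow n) -> bilin (fun a b => q (pr a) * pow n b).
  move=> hn; split=> [b|a] c x y; first by rewrite !linearP /= mulrDl -scalerAl.
  by rewrite hn mulrDr -scalerAr.
have pow_lin n : linear (pow n).
  elim: n => [|n IH] /=; first by apply: lin_scalar => c x y; rewrite linearP.
  exact: lin_tlift_comp (pow_bilin n IH) (linearP D).
have powE p n m : G p -> pow n (p m) = (n == m)%:R *: q (p 1%N) ^+ n.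
  move=> hp; elim: n m => [|n IH] m /=; first by rewrite (Gcurve hp).2 eq_sym.
  rewrite (tlift_curve _ _ (Gcurve hp)); last exact: pow_bilin.
  have z0 i (b : B) : i != 1%N -> q (pr (p i)) * b = 0.
    by move=> i1; rewrite prE // (negPf i1) scale0r linear0 mul0r.
  case: m => [|m]; first by rewrite /cauchy big_ord1 z0 // scale0r.
  rewrite /cauchy big_ord_recl z0 // add0r big_ord_recl big1 ?addr0 => [|i _]; last first.
    by rewrite z0.
  by rewrite prE // scale1r IH -scalerAr -exprS /= subSS subn0.
pose approx M z := \sum_(n < M) (n`!%:R)^-1 *: pow n z.
have approx_lin M : linear (approx M).
  by apply: lin_sum => n; apply/lin_scale/pow_lin.
have approxE p n M : G p -> (n < M)%N ->
    approx M (p n) = (n`!%:R)^-1 *: q (p 1%N) ^+ n.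
  move=> hp ltnM; rewrite /approx (bigD1 (Ordinal ltnM)) //= powE // eqxx scale1r.
  rewrite big1 ?addr0 // => i; rewrite -val_eqE /= => ni.
  by rewrite powE // (negPf ni) scale0r scaler0.
have [|F hF] := linear_limit approx_lin spG.
  move=> _ [p [n [hp ->]]]; exists ((n`!%:R)^-1 *: q (p 1%N) ^+ n), n.+1 => M.
  exact: approxE.
by exists F => p n hp; apply: (hF _ _ n.+1) => M; apply: approxE.
Qed.
End Lift.

(** * Exponential series in associative algebras *)

Section Exponential.
Variables (k : fieldType) (char0 : [pchar k] =i pred0) (B : algType k).
Implicit Types a x y : B.

Definition dpow x (n : nat) : B := (n`!%:R)^-1 *: x ^+ n.

Lemma natr_char0_neq0 n : n.+1%:R != 0 :> k.
Proof. by rewrite ((pcharf0P k).1 char0). Qed.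

Lemma fact_char0_neq0 n : n`!%:R != 0 :> k.
Proof. by rewrite ((pcharf0P k).1 char0) -lt0n fact_gt0. Qed.

Lemma dpow0 x : dpow x 0 = 1. Proof. by rewrite /dpow invr1 scale1r. Qed.

Lemma dpow1 x : dpow x 1 = x. Proof. by rewrite /dpow invr1 scale1r. Qed.

Lemma dpowSl x n : n.+1%:R *: dpow x n.+1 = x * dpow x n.
Proof.
rewrite /dpow -scalerAr -exprS scalerA factS natrM invfM mulrA.
by rewrite mulfV ?mul1r // natr_char0_neq0.
Qed.

Lemma dpowSr x n : n.+1%:R *: dpow x n.+1 = dpow x n * x.
Proof. by rewrite dpowSl /dpow -scalerAl -scalerAr -exprS -exprSr. Qed.

Lemma expr_dpow x n : x ^+ n = n`!%:R *: dpow x n.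
Proof. by rewrite /dpow scalerA mulfV ?scale1r // fact_char0_neq0. Qed.

Lemma dpow_scale c x n : dpow (c *: x) n = c ^+ n *: dpow x n.
Proof. by rewrite /dpow exprZn !scalerA mulrC. Qed.

Lemma dpow_zero n : dpow 0 n = (n == 0%N)%:R *: 1.
Proof. by case: n => [|n]; rewrite ?dpow0 ?scale1r // /dpow expr0n scaler0 scale0r. Qed.

Lemma amul_bilin : bilin (fun x y : B => x * y).
Proof. exact: amul_bilinear. Qed.

Lemma dpowD x y n : x * y = y * x ->
  cauchy (fun x y : B => x * y) (dpow x) (dpow y) n = dpow (x + y) n.
Proof.
move=> xy; rewrite cauchyC /dpow exprDn_comm // scaler_sumr.
apply: eq_bigr => i _; have lein : (i <= n)%N by rewrite -ltnS.
rewrite -scaler_nat scalerA -scalerAl -scalerAr scalerA; congr (_ *: _).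
have -> : n`!%:R = 'C(n, i)%:R * (i`!%:R * (n - i)`!%:R) :> k.
  by rewrite -!natrM bin_fact.
rewrite !invfM -mulrA [_ * 'C(n, i)%:R]mulrC mulrA mulVf ?mul1r 1?mulrC //.
by rewrite ((pcharf0P k).1 char0) -lt0n bin_gt0.
Qed.

Lemma dpow_inv x n :
  cauchy (fun x y : B => x * y) (dpow x) (dpow (- x)) n = (n == 0%N)%:R *: 1.
Proof. by rewrite dpowD ?subrr ?dpow_zero // mulrN mulNr. Qed.

(** The Leibniz rule for the derivation [d/ds] of power series in [s]. *)
Lemma cauchy_deriv (U V W : lmodType k) (f : U -> V -> W) p q n : bilin f ->
  n.+1%:R *: cauchy f p q n.+1 =
  cauchy f (fun i => i.+1%:R *: p i.+1) q n + cauchy f p (fun i => i.+1%:R *: q i.+1) n.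
Proof.
move=> [fl fr]; rewrite /cauchy.
have fZl c u v : f (c *: u) v = c *: f u v.
  exact: (linear_atZ _ _ (fl v)).
have fZr c u v : f u (c *: v) = c *: f u v.
  exact: (linear_atZ _ _ (fr u)).
transitivity (\sum_(i < n.+2) (i%:R *: f (p i) (q (n.+1 - i)%N))
              + \sum_(i < n.+2) ((n.+1 - i)%:R *: f (p i) (q (n.+1 - i)%N))).
  rewrite -big_split scaler_sumr; apply: eq_bigr => i _ /=.
  by rewrite -scalerDl -natrD subnKC // -ltnS.
congr (_ + _).
  rewrite big_ord_recl scale0r add0r; apply: eq_bigr => i _.
  by rewrite fZl /= subSS.
rewrite big_ord_recr /= subnn scale0r addr0; apply: eq_bigr => i _.
by rewrite fZr subSn // -ltnS.
Qed.

Lemma comm_pow_sum x a m :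
  \sum_(i < m) a ^+ i * (x * a - a * x) * a ^+ (m.-1 - i) = x * a ^+ m - a ^+ m * x.
Proof.
elim: m => [|m IH]; first by rewrite big_ord0 !expr0 mulr1 mul1r subrr.
rewrite big_ord_recr /= subnn expr0 mulr1.
transitivity ((x * a ^+ m - a ^+ m * x) * a + a ^+ m * (x * a - a * x)).
  rewrite -IH mulr_suml; congr (_ + _); apply: eq_bigr => i _.
  case: m i {IH} => [[]//|m] i /=; rewrite -[RHS]mulrA -exprSr subSn //.
  by rewrite -ltnS.
rewrite mulrBl mulrBr !mulrA addrA subrK.
by rewrite [a ^+ m.+1]exprSr !mulrA.
Qed.

(** The [v j] are the coefficients of a polynomial in the scalar [l]; its linear
coefficient is the derivative of the [N]-th power at [a] along [x]. *)
Lemma expand_pow a x N : exists v : nat -> B,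
  [/\ v 0%N = a ^+ N, v 1%N = \sum_(i < N) a ^+ i * x * a ^+ (N.-1 - i),
      forall j, (N < j)%N -> v j = 0
    & forall l : k, (a + l *: x) ^+ N = \sum_(j < N.+1) l ^+ j *: v j].
Proof.
elim: N => [|N [v [v0 v1 vN vE]]].
  exists (fun j => (j == 0%N)%:R *: 1); split=> [|||l].
  - by rewrite scale1r.
  - by rewrite scale0r big_ord0.
  - by case=> // j _; rewrite scale0r.
  - by rewrite big_ord1 !expr0 !scale1r.
exists (fun j => v j * a + (if j is j'.+1 then v j' * x else 0)).
split=> [||j|l].
- by rewrite v0 addr0 exprSr.
- rewrite v1 v0 big_ord_recr /= subnn expr0 mulr1 mulr_suml; congr (_ + _).
  apply: eq_bigr => i _; rewrite -[LHS]mulrA -exprSr; congr (_ * _ ^+ _).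
  by case: N i {v0 v1 vN vE} => [[]//|N] i /=; rewrite subSn // -ltnS.
- by case: j => // j ltNj; rewrite !vN ?mul0r ?addr0 // ltnW.
rewrite exprSr vE mulrDr -scalerAr.
under [RHS]eq_bigr do rewrite scalerDr.
rewrite big_split /=; congr (_ + _).
  rewrite [RHS]big_ord_recr /= vN // mul0r scaler0 addr0 mulr_suml.
  by apply: eq_bigr => j _; rewrite scalerAl.
rewrite [RHS]big_ord_recl scaler0 add0r mulr_suml scaler_sumr.
by apply: eq_bigr => j _; rewrite -scalerAl scalerA exprS.
Qed.

(** Polarization: the sum is the coefficient of [l] in [(a + l x) ^ N]. *)
Lemma subspace_polarize (P : B -> Prop) a x N : subspace P ->
  (forall l : k, P ((a + l *: x) ^+ N)) ->
  P (\sum_(i < N) a ^+ i * x * a ^+ (N.-1 - i)).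
Proof.
move=> hP h; have [v [_ v1 vN vE]] := expand_pow a x N; rewrite -v1.
have [N0|N0] := posnP N; first by rewrite vN ?N0 //; apply: (subspace0 hP).
apply: (subspace_coef char0 (N := N.+1) hP) => // m.
rewrite (eq_bigr (fun j : 'I__ => ((2 ^ m)%:R ^+ j) *: v j)) -?vE // => j _.
by rewrite -natrX expnM.
Qed.
End Exponential.

(** * Spanning by powers *)

Section Spanning.
Variables (k : fieldType) (char0 : [pchar k] =i pred0) (g : lieAlgType k).
Local Notation A := (uea g).
Local Notation i_ := (@uea_inj k g).

Definition uea_inj_lin : {linear g -> A} := mklin (uea_inj_hom g).1.

Lemma uea_injB (x y : g) : i_ [lie x, y] = i_ x * i_ y - i_ y * i_ x.
Proof. exact: (uea_inj_hom g).2. Qed.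

Definition word (l : seq g) : A := \prod_(x <- l) i_ x.

Lemma word_cat l l' : word (l ++ l') = word l * word l'.
Proof. exact: big_cat. Qed.

Lemma word_nseq n x : word (nseq n x) = i_ x ^+ n.
Proof. by rewrite /word big_nseq -Monoid.iteropE. Qed.

Lemma word_cons x l : word (x :: l) = i_ x * word l.
Proof. exact: big_cons. Qed.

Definition pow_upto (c : {pred g}) n (y : A) : Prop :=
  exists a m, [/\ a \in c, (m <= n)%N & y = i_ a ^+ m].

Section Filtration.
Variables (s c : {pred g}).
Hypothesis hc : submod_closed c.
Hypothesis sc : forall x, exists a b, [/\ a \in s, b \in c & x = a + b].

Definition filt n (z : A) : Prop :=
  exists2 w, span (pow_upto c n) w & left_ideal s (z - w).

Lemma filt_subspace n : subspace (filt n).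
Proof.
have hS := span_subspace (pow_upto c n); split.
  by exists 0; [exact: (subspace0 hS)|rewrite subrr; apply: left_ideal0].
move=> a x y [w hw hx] [v hv hy]; exists (a *: w + v); first exact: hS.2.
rewrite opprD addrACA -scalerBr; apply: left_idealD => //; exact: left_idealZ.
Qed.

Lemma filt_le n m z : (n <= m)%N -> filt n z -> filt m z.
Proof.
move=> le_nm [w hw hz]; exists w => //; apply: span_sub hw => y [a [p [ac lp ->]]].
by apply: span_gen; exists a, p; split=> //; apply: leq_trans le_nm.
Qed.

Lemma filt_pow n a : a \in c -> filt n (i_ a ^+ n).
Proof.
move=> ac; exists (i_ a ^+ n); first by apply: span_gen; exists a, n.
by rewrite subrr; apply: left_ideal0.
Qed.

Lemma filt_ideal n z : left_ideal s z -> filt n z.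
Proof. by move=> hz; exists 0; [apply: (subspace0 (span_subspace _))|rewrite subr0]. Qed.

(** Modulo [U(g) s] and words of smaller length, letters can be permuted, a letter
of [s] can be moved to the end, and words in [c] can be symmetrized. *)
Lemma filt_word l : filt (size l) (word l).
Proof.
elim: {l}(size l) {-2}l (leqnn (size l)) => [|n IH] l.
  by case: l => // _; rewrite /word big_nil -(expr0 (i_ 0)); apply/filt_pow/hc.1.
rewrite leq_eqVlt => /predU1P[|/IH //]; case: l => // x l [szl].
rewrite word_cons /= szl; have [w hw hl] := IH l (eq_leq szl).
rewrite szl in hw.
have step m a : (m <= n)%N -> a \in c -> filt n.+1 (i_ x * i_ a ^+ m).
  move=> le_mn ac; have [xs [xc [hxs hxc ->]]] := sc x.
  have comm y : filt m (i_ y * i_ a ^+ m - i_ a ^+ m * i_ y).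
    rewrite -comm_pow_sum; apply: (subspace_sum (filt_subspace m)) => i.
    rewrite -uea_injB -!word_nseq.
    have -> : word (nseq i a) * i_ [lie y, a] * word (nseq (m.-1 - i) a)
            = word (nseq i a ++ [lie y, a] :: nseq (m.-1 - i) a).
      by rewrite word_cat word_cons mulrA.
    set l' := _ ++ _; have sz : size l' = m.
      rewrite size_cat /= !size_nseq; case: m {le_mn l'} i => [[]//|m] i /=.
      by rewrite addnS subnKC // -ltnS.
    by rewrite -sz; apply: IH; rewrite sz.
  have hsub := filt_subspace n.+1.
  rewrite -[i_]/(uea_inj_lin : _ -> _) linearD mulrDl /=.
  apply: (subspaceD hsub).
    rewrite -[X in filt _ X](subrK (i_ a ^+ m * i_ xs)).
    apply: (subspaceD hsub).
      by apply: filt_le (comm xs); apply: leqW.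
    apply: filt_ideal; exists [:: (i_ a ^+ m, xs)]; split; last by rewrite big_seq1.
    by move=> p; rewrite inE => /eqP->.
  have pol : filt n.+1 (\sum_(i < m.+1) i_ a ^+ i * i_ xc * i_ a ^+ (m - i)).
    apply: (subspace_polarize char0 (N := m.+1) hsub) => q.
    apply: (@filt_le m.+1); first by rewrite ltnS.
    rewrite -[i_]/(uea_inj_lin : _ -> _) -linearZ -linearD.
    by apply: filt_pow; rewrite addrC; apply: hc.2.
  rewrite -[X in filt _ X](@scalerK _ _ m.+1%:R) ?natr_char0_neq0 //.
  apply: (subspaceZ hsub).
  have -> : m.+1%:R *: (i_ xc * i_ a ^+ m) =
      \sum_(i < m.+1) i_ a ^+ i * i_ xc * i_ a ^+ (m - i) +
      \sum_(i < m.+1) (i_ xc * i_ a ^+ i - i_ a ^+ i * i_ xc) * i_ a ^+ (m - i).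
    rewrite -big_split /= (eq_bigr (fun _ => i_ xc * i_ a ^+ m)) => [|i _].
      by rewrite sumr_const card_ord scaler_nat.
    rewrite mulrBl addrC subrK -mulrA -exprD subnKC //.
    by rewrite -ltnS.
  apply: (subspaceD hsub pol); apply: (subspace_sum hsub) => i.
  have le_im : (i <= m)%N by rewrite -ltnS.
  rewrite -comm_pow_sum mulr_suml; apply: (subspace_sum hsub) => j.
  rewrite -uea_injB -!word_nseq -mulrA -word_cons -!word_cat.
  set l' := _ ++ _; have sz : size l' = m.
    rewrite !size_cat /= !size_nseq {l'}.
    case: (i : nat) j le_im => [[]//|p] j le_im /=.
    by rewrite addnS subnKC ?subnKC // -ltnS.
  apply: (@filt_le m); first exact: leqW.
  by rewrite -sz; apply: IH; rewrite sz.
rewrite -(subrK w (word l)) mulrDr; apply: (subspaceD (filt_subspace _)).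
  by apply: filt_ideal; apply: left_idealM.
refine (hw (fun w => filt n.+1 (i_ x * w)) _ _).
  apply: (@subspace_preim k A A (fun w => i_ x * w)); last exact: filt_subspace.
  exact: (amul_bilin A).2.
by move=> _ [a [m [ac le_mn ->]]]; apply: step.
Qed.

Lemma uea_filt z : exists n, filt n z.
Proof.
rewrite [z]uea_sum; elim: (repr z : ncpoly g) => [|p l [n IH]].
  by exists 0%N; rewrite big_nil; apply: (subspace0 (filt_subspace _)).
exists (maxn (size p.2) n); rewrite big_cons.
apply: (subspaceD (filt_subspace _)); last exact: filt_le (leq_maxr _ _) IH.
apply: (subspaceZ (filt_subspace _)); apply: filt_le (leq_maxl _ _) _.
exact: filt_word.
Qed.
End Filtration.

(* The triple with zero subalgebra: words in [g] are combinations of powers. *)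
Let s0 : {pred g} := fun x => x == 0.
Let cT : {pred g} := predT.

Let left_ideal_s0 z : left_ideal s0 z -> z = 0.
Proof.
move=> [l [hl ->]]; rewrite big1_seq // => p /andP[_ /hl].
rewrite -topredE /= /s0 => /eqP ->.
by rewrite -[i_]/(uea_inj_lin : _ -> _) linear0 mulr0.
Qed.

Let filt_s0 n z : filt s0 cT n z -> span (pow_upto cT n) z.
Proof. by move=> [w hw /left_ideal_s0/eqP]; rewrite subr_eq0 => /eqP->. Qed.

Let cT_closed : submod_closed cT. Proof. by split. Qed.
Let s0cT x : exists a b, [/\ a \in s0, b \in cT & x = a + b].
Proof. by exists 0, x; split; rewrite ?add0r // -topredE /= /s0 eqxx. Qed.

Lemma word_span_pow l : span (pow_upto predT (size l)) (word l).
Proof. apply: filt_s0; exact: filt_word. Qed.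

Lemma uea_span_pow z : exists n, span (pow_upto predT n) z.
Proof. by have [n hn] := uea_filt cT_closed s0cT z; exists n; apply: filt_s0. Qed.

End Spanning.

(** * The enveloping algebra *)

Section Enveloping.
Variables (k : fieldType) (char0 : [pchar k] =i pred0) (g : lieAlgType k).
Local Notation A := (uea g).
Local Notation i_ := (@uea_inj k g).
Local Notation mulA := (fun x y : A => x * y).
Local Notation Acurve := (curve (@uea_comul k g) (@uea_counit k g)).
Local Notation Amap := (curve_map (@uea_comul k g) (@uea_counit k g)
                                  (@uea_comul k g) (@uea_counit k g)).

Lemma uea_inj0 : i_ 0 = 0.
Proof. exact: (linear0 (uea_inj_lin g)). Qed.
Lemma uea_injD x y : i_ (x + y) = i_ x + i_ y.
Proof. exact: (linearD (uea_inj_lin g)). Qed.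
Lemma uea_injN x : i_ (- x) = - i_ x.
Proof. exact: (linearN (uea_inj_lin g)). Qed.
Lemma uea_injZ c x : i_ (c *: x) = c *: i_ x.
Proof. exact: (linearZ_LR (uea_inj_lin g)). Qed.

Lemma curve_dpow x : Acurve (dpow (i_ x)).
Proof.
split=> n; last first.
  rewrite linearZ rmorphXn /= uea_counit_inj.
  by case: n => [|n]; rewrite ?expr0n ?mulr0 // invr1 mulr1.
rewrite linearZ rmorphXn /= uea_comul_inj -/(dpow _ n).
have powl m : dpow (i_ x \ot (1 : A)) m = dpow (i_ x) m \ot 1.
  rewrite /dpow linearZl_LR; congr (_ *: _).
  by elim: m => // m IH; rewrite !exprS IH uea_tensorM mul1r.
have powr m : dpow ((1 : A) \ot i_ x) m = 1 \ot dpow (i_ x) m.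
  rewrite /dpow linearZr_LR; congr (_ *: _).
  by elim: m => // m IH; rewrite !exprS IH uea_tensorM mul1r.
rewrite -dpowD //; last by rewrite !uea_tensorM !mul1r !mulr1.
by apply: eq_bigr => i _; rewrite powl powr uea_tensorM mul1r mulr1.
Qed.

Definition exp_curve (p : nat -> A) : Prop := exists x, p = dpow (i_ x).

Lemma exp_curveP p : exp_curve p -> Acurve p.
Proof. by move=> [x ->]; apply: curve_dpow. Qed.

Lemma exp_curve_span z : span (fun y => exists p n, exp_curve p /\ y = p n) z.
Proof.
have [n hn] := uea_span_pow char0 z; apply: span_sub hn => _ [x [m [_ _ ->]]].
rewrite expr_dpow //; apply: (subspaceZ (span_subspace _)); apply: span_gen.
by exists (dpow (i_ x)), m; split=> //; exists x.
Qed.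

Lemma sw_exp (W : lmodType k) (F : A -> A -> W) x n : bilin F ->
  tlift F (uea_comul (dpow (i_ x) n)) = cauchy F (dpow (i_ x)) (dpow (i_ x)) n.
Proof. by move=> hF; apply: tlift_curve => //; apply: curve_dpow. Qed.

(** The map [z |-> z_(1) z_(2)] squares [exp (s x)], which gives [exp (2 s x)]. *)
Lemma uea_degree_one : exists pr : {linear A -> A},
  (forall x n, pr (dpow (i_ x) n) = (n == 1%N)%:R *: i_ x) /\
  (forall z, exists x, pr z = i_ x).
Proof.
pose psi := mklin (lin_tlift_comp (amul_bilin A) (linearP (@uea_comul k g))).
have [|pr hpr] := @degree_one k char0 A exp_curve exp_curve_span psi.
  move=> _ n [x ->] /=; rewrite sw_exp; last exact: amul_bilin.
  by rewrite dpowD // -mulr2n -scaler_nat dpow_scale natrX.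
have prE x n : pr (dpow (i_ x) n) = (n == 1%N)%:R *: i_ x.
  by rewrite hpr ?dpow1 //; exists x.
exists pr; split=> // z.
refine (exp_curve_span z (P := fun z => exists x, pr z = i_ x) _ _).
  split=> [|a y y' [x hx] [x' hx']]; first by exists 0; rewrite linear0 uea_inj0.
  by exists (a *: x + x'); rewrite linearP uea_injD uea_injZ hx hx'.
move=> _ [_ [n [[x ->] ->]]]; exists ((n == 1%N)%:R *: x).
by rewrite prE uea_injZ.
Qed.

Lemma uea_exp_lift (B : algType k) (q : {linear A -> B}) :
  exists F : {linear A -> B}, forall x n, F (dpow (i_ x) n) = dpow (q (i_ x)) n.
Proof.
have [pr [prE _]] := uea_degree_one.
have [|F hF] := @exp_lift k A _ _ _ exp_curveP exp_curve_span pr _ B q.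
  by move=> _ n [x ->]; rewrite prE dpow1.
by exists F => x n; rewrite hF ?dpow1 //; exists x.
Qed.

Lemma uea_map_of_exp (f : {linear A -> A}) (h : g -> g) :
  (forall x n, f (dpow (i_ x) n) = dpow (i_ (h x)) n) -> Amap f.
Proof.
move=> hf; apply: (curve_map_gen exp_curveP exp_curve_span (linearP f)).
move=> _ [x ->]; have := curve_dpow (h x).
by rewrite (_ : f \o _ = dpow (i_ (h x))) //; apply: funext => n; apply: hf.
Qed.

(** The antipode lifts [x |-> - x]; its properties are that [exp (- s x)] inverts
[exp (s x)]. *)
Lemma uea_antipode : exists S : {linear A -> A},
  [/\ Amap S, forall x n, S (dpow (i_ x) n) = dpow (- i_ x) n,
      forall p n, Acurve p ->
        cauchy mulA (fun i => S (p i)) p n = (n == 0%N)%:R *: 1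
    & forall p n, Acurve p ->
        cauchy mulA p (fun i => S (p i)) n = (n == 0%N)%:R *: 1].
Proof.
have [S SE] := uea_exp_lift (mklin (lin_scale (-1) (@lin_id k A))).
have {}SE x n : S (dpow (i_ x) n) = dpow (- i_ x) n by rewrite SE /= scaleN1r.
have S1 : bilin (fun a b => S a * b).
  split=> [b|a]; last exact: (amul_bilin A).2.
  exact: (lin_comp ((amul_bilin A).1 b) (linearP S)).
have S2 : bilin (fun a b => a * S b).
  split=> [b|a]; first exact: (amul_bilin A).1.
  exact: (lin_comp ((amul_bilin A).2 a) (linearP S)).
have eps_lin : linear (fun z => @uea_counit k g z *: (1 : A)).
  by apply: lin_scalar => c x y; rewrite linearP.
exists S; split=> //.
- by apply: (uea_map_of_exp (h := fun x => - x)) => x n; rewrite uea_injN.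
- move=> p n hp; transitivity (\sw_(a, b <- uea_comul (p n)) (S a * b)).
    by rewrite (tlift_curve n S1 hp).
  rewrite -hp.2.
  apply: (eq_on_span (lin_tlift_comp S1 (linearP _)) eps_lin _ (exp_curve_span (p n))).
  move=> _ [_ [m [[x ->] ->]]]; rewrite sw_exp // (curve_dpow x).2.
  rewrite -(dpow_inv char0 (- i_ x) m) opprK.
  by apply: eq_bigr => i _; rewrite SE.
- move=> p n hp; transitivity (\sw_(a, b <- uea_comul (p n)) (a * S b)).
    by rewrite (tlift_curve n S2 hp).
  rewrite -hp.2.
  apply: (eq_on_span (lin_tlift_comp S2 (linearP _)) eps_lin _ (exp_curve_span (p n))).
  move=> _ [_ [m [[x ->] ->]]]; rewrite sw_exp // (curve_dpow x).2.
  rewrite -(dpow_inv char0 (i_ x) m).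
  by apply: eq_bigr => i _; rewrite SE.
Qed.

Lemma curve_mulA p q : Acurve p -> Acurve q -> Acurve (cauchy mulA p q).
Proof.
apply: (curve_cauchy (amul_bilin A)) => x y; last by rewrite rmorphM.
by rewrite rmorphM.
Qed.
End Enveloping.

(** * Factoring the enveloping algebra along a subspace and its normalizer *)

Section Normalizer.
Variables (k : fieldType) (char0 : [pchar k] =i pred0) (g : lieAlgType k).
Variables (c : {pred g}) (hc : submod_closed c).
Local Notation A := (uea g).
Local Notation i_ := (@uea_inj k g).
Local Notation mulA := (fun x y : A => x * y).
Local Notation N := (lie_normalizer c).

(** The image of the symmetric algebra of [c] under symmetrization. *)
Definition sym_span (z : A) : Prop :=
  span (fun y => exists a n, a \in c /\ y = i_ a ^+ n) z.

Lemma sym_span_subspace : subspace sym_span.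
Proof. exact: span_subspace. Qed.

Lemma sym_span_pow a n : a \in c -> sym_span (i_ a ^+ n).
Proof. by move=> ac; apply: span_gen; exists a, n. Qed.

Lemma sym_span_dpow a n : a \in c -> sym_span (dpow (i_ a) n).
Proof. by move=> ac; apply: (subspaceZ sym_span_subspace); apply: sym_span_pow. Qed.

Lemma sym_span_ad a y : N a -> sym_span y -> sym_span (i_ a * y - y * i_ a).
Proof.
move=> Na hy; have hS := sym_span_subspace.
refine (hy (fun y => sym_span (i_ a * y - y * i_ a)) _ _).
  apply: (@subspace_preim k A A (fun y => i_ a * y - y * i_ a) sym_span _ hS).
  apply: (@lin_sub k A A (fun y => i_ a * y) (fun y => y * i_ a)).
    exact: (amul_bilin A).2.
  exact: (amul_bilin A).1.
move=> _ [b [n [bc ->]]]; rewrite -comm_pow_sum.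
under eq_bigr do rewrite -uea_injB.
apply: (subspace_polarize char0 hS) => l; rewrite -uea_injZ -uea_injD addrC.
by apply: sym_span_pow; apply: hc.2 => //; apply: Na.
Qed.

(** [exp (s a) Y exp (- s a)] solves [R' = a R - R a]. *)
Lemma sym_span_Ad a y n : N a -> sym_span y ->
  sym_span (cauchy (fun u v : A => u * y * v) (dpow (i_ a)) (dpow (- i_ a)) n).
Proof.
move=> Na hy; have hS := sym_span_subspace.
have B : bilin (fun u v : A => u * y * v).
  split=> [v|u]; last exact: (amul_bilin A).2.
  exact: (lin_comp ((amul_bilin A).1 v) ((amul_bilin A).1 y)).
elim: n => [|n IH]; first by rewrite /cauchy big_ord1 !dpow0 mul1r mulr1.
rewrite -[X in sym_span X](@scalerK _ _ n.+1%:R) ?natr_char0_neq0 //.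
apply: (subspaceZ hS); rewrite cauchy_deriv //.
set R := cauchy _ _ _ n in IH.
have -> : cauchy (fun u v : A => u * y * v)
     (fun i => i.+1%:R *: dpow (i_ a) i.+1) (dpow (- i_ a)) n = i_ a * R.
  rewrite mulr_sumr; apply: eq_bigr => i _.
  by rewrite dpowSl // -!mulrA.
have -> : cauchy (fun u v : A => u * y * v)
     (dpow (i_ a)) (fun i => i.+1%:R *: dpow (- i_ a) i.+1) n = - (R * i_ a).
  rewrite mulr_suml -sumrN; apply: eq_bigr => i _.
  by rewrite dpowSr // mulrA !mulrN.
exact: sym_span_ad.
Qed.
End Normalizer.

Section Factorization.
Variables (k : fieldType) (char0 : [pchar k] =i pred0) (g : lieAlgType k).
Variables (c : {pred g}) (hc : submod_closed c).
Local Notation A := (uea g).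
Local Notation i_ := (@uea_inj k g).
Local Notation mulA := (fun x y : A => x * y).
Local Notation N := (lie_normalizer c).
Local Notation Acurve := (curve (@uea_comul k g) (@uea_counit k g)).
Local Notation Amap := (curve_map (@uea_comul k g) (@uea_counit k g)
                                  (@uea_comul k g) (@uea_counit k g)).
Hypothesis Nc : forall x, exists a b, [/\ N a, b \in c & x = a + b].

Let upto n (z : A) : Prop := span (pow_upto predT n) z.

Let upto_sub n : subspace (upto n). Proof. exact: span_subspace. Qed.

Let upto_le n m z : (n <= m)%N -> upto n z -> upto m z.
Proof.
move=> le_nm; apply: span_sub => y [a [p [ac lp ->]]].
by apply: span_gen; exists a, p; split=> //; apply: leq_trans le_nm.
Qed.

Let upto_word n l : (size l <= n)%N -> upto n (word l).
Proof. by move=> h; apply: (@upto_le (size l)) => //; apply: word_span_pow. Qed.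

Let upto_mull n x z : upto n z -> upto n.+1 (i_ x * z).
Proof.
move=> hz; refine (hz (fun z => upto n.+1 (i_ x * z)) _ _).
  exact: (@subspace_preim k A A (fun y => i_ x * y) _ ((amul_bilin A).2 _) (upto_sub _)).
move=> _ [a [m [_ le_mn ->]]]; rewrite -word_nseq -word_cons.
by apply: upto_word; rewrite /= size_nseq.
Qed.

Let upto_mulr n x z : upto n z -> upto n.+1 (z * i_ x).
Proof.
move=> hz; refine (hz (fun z => upto n.+1 (z * i_ x)) _ _).
  exact: (@subspace_preim k A A (fun y => y * i_ x) _ ((amul_bilin A).1 _) (upto_sub _)).
move=> _ [a [m [_ le_mn ->]]].
have -> : i_ a ^+ m * i_ x = word (nseq m a ++ [:: x]).
  by rewrite word_cat word_nseq word_cons [word [::]]big_nil mulr1.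
by apply: upto_word; rewrite size_cat size_nseq addn1.
Qed.

(** The difference [E] of [exp (s (x + y))] and [exp (s x) exp (s y)] satisfies
[E' = x E + E y] up to a commutator with [y], which lowers the degree. *)
Lemma exp_split_lower x y n : upto n
  (dpow (i_ x + i_ y) n.+1 - cauchy mulA (dpow (i_ x)) (dpow (i_ y)) n.+1).
Proof.
pose E n := dpow (i_ x + i_ y) n - cauchy mulA (dpow (i_ x)) (dpow (i_ y)) n.
have ES m : m.+1%:R *: E m.+1 =
    i_ x * E m + E m * i_ y + (i_ y * dpow (i_ x + i_ y) m - dpow (i_ x + i_ y) m * i_ y).
  rewrite /E scalerBr (cauchy_deriv _ _ _ (amul_bilin A)) dpowSl //.
  set c1 := cauchy _ _ _ m; set c2 := cauchy _ _ _ m; set d := dpow _ m.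
  set c0 := cauchy _ _ _ m.
  have -> : c1 = i_ x * c0.
    by rewrite /c1 /c0 mulr_sumr; apply: eq_bigr => i _; rewrite dpowSl // mulrA.
  have -> : c2 = c0 * i_ y.
    by rewrite /c2 /c0 mulr_suml; apply: eq_bigr => i _; rewrite dpowSr // mulrA.
  rewrite mulrDl mulrBr mulrBl opprD; set p := i_ x * d; set q := i_ x * c0.
  set r := c0 * i_ y; set t := i_ y * d.
  have -> : p - q + (d * i_ y - r) + (t - d * i_ y) = p - q + (t - r).
    by rewrite -addrA; congr (_ + _); rewrite addrC addrA subrK.
  by rewrite addrACA.
have E0 : E 0%N = 0 by rewrite /E dpow0 /cauchy big_ord1 !dpow0 mulr1 subrr.
rewrite -/(E n.+1); elim: n => [|n IH].
  have := ES 0%N; rewrite E0 mul0r mulr0 addr0 add0r dpow0 mulr1 mul1r subrr scale1r.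
  by move=> ->; apply: (subspace0 (upto_sub _)).
rewrite -[X in upto _ X](@scalerK _ _ n.+2%:R) ?natr_char0_neq0 //.
apply: (subspaceZ (upto_sub _)); rewrite ES.
apply: (subspaceD (upto_sub _)).
  apply: (subspaceD (upto_sub _)); first exact: upto_mull.
  exact: upto_mulr.
rewrite /dpow -scalerAl -scalerAr -scalerBr; apply: (subspaceZ (upto_sub _)).
rewrite -uea_injD -comm_pow_sum; apply: (subspace_sum (upto_sub _)) => i.
rewrite -uea_injB -!word_nseq -mulrA -word_cons -word_cat.
by apply: upto_word; rewrite size_cat /= !size_nseq addnS subnKC // -ltnS.
Qed.

(** The decomposition [g = N + c], made linear. *)
Lemma normalizer_projection : exists P : {linear A -> A},
  forall x, exists b a, [/\ b \in c, N a, P (i_ x) = i_ b & i_ x = i_ (a + b)].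
Proof.
have [pr [prE prg]] := uea_degree_one char0 g.
pose R z w := exists b a, [/\ b \in c, N a, w = i_ b & pr z = i_ (a + b)].
have [|l z w z' w' [b [a [bc Na -> e]]] [b' [a' [bc' Na' -> e']]]|P hP] :=
    @linear_selection k A A R.
- move=> z; have [x hx] := prg z; have [a [b [Na bc ex]]] := Nc x.
  by exists (i_ b), b, a; rewrite -ex.
- exists (l *: b + b'), (l *: a + a'); split.
  + exact: hc.2.
  + by move=> y yc; rewrite lbr_linearl; apply: hc.2; [apply: Na|apply: Na'].
  + by rewrite uea_injD uea_injZ.
  + by rewrite linearP e e' addrACA -scalerDr -uea_injZ -uea_injD.
exists P => x; have [b [a [bc Na e e']]] := hP (i_ x); exists b, a; split=> //.
by rewrite -e' -[i_ x](@dpow1 k) prE scale1r (@dpow1 k).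
Qed.

(** In group terms [z = exp (s b) exp (s a)] is [t^-1 n], and [tau] and [eta] send it
to [t] and [n]. *)
Definition split_curve (tau eta : A -> A) (p : nat -> A) : Prop :=
  exists b a, [/\ b \in c, N a, p = cauchy mulA (dpow (i_ b)) (dpow (i_ a)),
    forall n, tau (p n) = dpow (- i_ b) n & forall n, eta (p n) = dpow (i_ a) n].

(** The map [Psi] sending [exp (s x)] to [exp (s b) exp (s a)], for the chosen
decomposition [x = a + b], is unipotent for the degree filtration. Composing the
lifts of [x |-> - b] and [x |-> a] with its inverse reads off the two factors. *)
Lemma split_curves_span : exists tau eta : {linear A -> A},
  tau 1 = 1 /\
  forall z, span (fun y => exists p n, split_curve tau eta p /\ y = p n) z.
Proof.
have [P hP] := normalizer_projection.
have [Fc FcE] := uea_exp_lift char0 P.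
have [F' F'E] := uea_exp_lift char0 (mklin (lin_scale (-1) (linearP P))).
have [Fn FnE] := uea_exp_lift char0 (mklin (lin_sub (@lin_id k A) (linearP P))).
have B : bilin (fun u v => Fc u * Fn v).
  split=> [v|u]; first exact: (lin_comp ((amul_bilin A).1 _) (linearP Fc)).
  exact: (lin_comp ((amul_bilin A).2 _) (linearP Fn)).
pose Psi z := \sw_(u, v <- uea_comul z) (Fc u * Fn v).
have Psi_lin : linear Psi by apply: (lin_tlift_comp B (linearP (@uea_comul k g))).
have PsiE x : exists b a, [/\ b \in c, N a, i_ x = i_ (a + b),
    P (i_ x) = i_ b & forall n, Psi (dpow (i_ x) n) =
      cauchy mulA (dpow (i_ b)) (dpow (i_ a)) n].
  have [b [a [bc Na e e']]] := hP x; exists b, a; split=> // n.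
  rewrite /Psi sw_exp //; apply: eq_bigr => i _; rewrite FcE FnE e /= e.
  by rewrite e' uea_injD addrK.
pose T z := z - Psi z.
have T_lin : linear T by apply: (lin_sub (@lin_id k A) Psi_lin).
have T_lower n x : upto n (T (i_ x ^+ n.+1)).
  have [b [a [bc Na e' e E]]] := PsiE x.
  rewrite expr_dpow // -[T]/(mklin T_lin : _ -> _) linearZ /= /T E e'.
  rewrite [a + b]addrC uea_injD; apply: (subspaceZ (upto_sub _)).
  exact: exp_split_lower.
have T_one : T 1 = 0.
  have [b [a [bc Na e' e E]]] := PsiE 0.
  rewrite /T -[X in X - _](dpow0 (i_ 0)) -[X in Psi X](dpow0 (i_ 0)) E.
  by rewrite /cauchy big_ord1 !dpow0 mulr1 subrr.
have iter_lin n : linear (iter n T).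
  by elim: n => [|n IH] //; exact: (lin_comp T_lin IH).
have T_nil n z : upto n z -> iter n.+1 T z = 0.
  elim: n z => [|n IH] z; move: z; apply: (eq_on_span (iter_lin _) (@lin0 k A A)).
    by move=> _ [a [m [_ + ->]]]; rewrite leqn0 => /eqP->; rewrite expr0.
  move=> _ [a [[|m] [_ le_mn ->]]].
    by rewrite iterSr expr0 T_one; apply: (linear0 (mklin (iter_lin n.+1))).
  by rewrite iterSr IH //; apply: upto_le (T_lower m a).
have [|I [KI IK]] := loc_nilpotent_inv T_lin (exp_curve_span char0 (g := g)).
  move=> _ [_ [n [[x ->] ->]]]; exists n.+1; apply: T_nil.
  by apply: (subspaceZ (upto_sub _)); apply: span_gen; exists x, n.
have PsiI z : Psi (I z) = z by rewrite -[RHS]IK /T opprB addrC subrK.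
have IPsi z : I (Psi z) = z by rewrite -[RHS]KI /T opprB addrC subrK.
exists (F' \o I : {linear A -> A}), (Fn \o I : {linear A -> A}); split.
  have e1 : Psi (dpow (i_ 0) 0) = 1.
    by move/eqP: T_one; rewrite dpow0 subr_eq0 => /eqP.
  by rewrite -[X in _ X = _]e1 /= IPsi F'E dpow0.
move=> z; rewrite -(PsiI z).
refine (exp_curve_span char0 (I z) (subspace_preim Psi_lin (span_subspace _)) _).
move=> _ [_ [n [[x ->] ->]]]; apply: span_gen.
have [b [a [bc Na e' e E]]] := PsiE x.
exists (fun n => Psi (dpow (i_ x) n)), n; split=> //; exists b, a; split=> // [|m|m].
- exact: funext.
- by rewrite /= IPsi F'E /= scaleN1r e.
- by rewrite /= IPsi FnE /= e e' uea_injD addrK.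
Qed.

(** In group terms [tau z = t] and [eta z = n] with [t z = n], and
[Q z y = n y n^-1]. *)
Lemma normalizer_factorization : exists tau eta : {linear A -> A},
  [/\ [/\ Amap tau, forall z, sym_span c (tau z) & tau 1 = 1],
      forall z, \sw_(u, v <- uea_comul z) (tau v * u) = eta z
    & exists Q : A -> A -> A,
      [/\ bilin Q, forall z y, sym_span c y -> sym_span c (Q z y)
        & forall z y, \sw_(u, v <- uea_comul z) (Q v y * eta u) = eta z * y]].
Proof.
have [tau [eta [tau1 sp]]] := split_curves_span.
have [S [Smap SE SV VS]] := uea_antipode char0 g.
have curveP p : split_curve tau eta p -> Acurve p.
  by move=> [b [a [_ _ -> _ _]]]; apply: curve_mulA; apply: curve_dpow.
have cN b : b \in c -> - b \in c.
  by move=> bc; apply: (subspaceN (subspace_mem hc)).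
exists tau, eta; split.
- split=> // [|z].
    apply: (curve_map_gen curveP sp (linearP tau)) => p [b [a [_ _ _ tE _]]].
    rewrite (_ : _ \o _ = dpow (i_ (- b))); first exact: curve_dpow.
    by apply: funext => n; rewrite /= tE uea_injN.
  refine (sp z _ (subspace_preim (linearP tau) (sym_span_subspace c)) _).
  move=> _ [p [n [[b [a [bc _ _ tE _]]] ->]]]; rewrite tE -uea_injN.
  by apply: sym_span_dpow; apply: cN.
- have B : bilin (fun u v => tau v * u).
    split=> [v|u]; first exact: (amul_bilin A).2.
    exact: (lin_comp ((amul_bilin A).1 _) (linearP tau)).
  move=> z.
  apply: (eq_on_span (lin_tlift_comp B (linearP _)) (linearP eta) _ (sp z)).
  move=> _ [p [n [hp ->]]]; rewrite (tlift_curve _ B (curveP p hp)) cauchyC.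
  have [b [a [_ _ pE tE ->]]] := hp.
  transitivity (cauchy mulA (dpow (- i_ b)) p n).
    by apply: eq_bigr => i _; rewrite tE.
  rewrite pE -(cauchyA (f := mulA) (g := mulA) (f' := mulA) (g' := mulA)).
  + rewrite (eq_cauchy (p' := fun i => (i == 0%N)%:R *: 1) (f' := mulA)
       (q' := dpow (i_ a))) // => [|i]; last by have := dpow_inv char0 (- i_ b) i; rewrite opprK.
    by rewrite cauchy_deltal ?mul1r //; exact: (amul_bilin A).1.
  + exact: (amul_bilin A).1.
  + exact: (amul_bilin A).2.
  + by move=> x y w; rewrite mulrA.
- pose Q z y := \sw_(u, v <- uea_comul z) (eta u * y * S (eta v)).
  have B y : bilin (fun u v => eta u * y * S (eta v)).
    split=> [v|u].
      exact: (lin_comp (lin_comp ((amul_bilin A).1 _) ((amul_bilin A).1 _)) (linearP eta)).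
    exact: (lin_comp ((amul_bilin A).2 _) (lin_comp (linearP S) (linearP eta))).
  have Qlin : bilin Q.
    split=> [y|z]; first exact: (lin_tlift_comp (B y) (linearP _)).
    apply: lin_tlift => u v.
    exact: (lin_comp ((amul_bilin A).1 _) ((amul_bilin A).2 _)).
  have QE p y : split_curve tau eta p -> exists a, [/\ N a,
      forall i, eta (p i) = dpow (i_ a) i & forall i, Q (p i) y =
        cauchy (fun u v : A => u * y * v) (dpow (i_ a)) (dpow (- i_ a)) i].
    move=> hp; have [b [a [_ Na _ _ eE]]] := hp; exists a; split=> // i.
    rewrite /Q (tlift_curve _ (B y) (curveP p hp)).
    by apply: eq_bigr => j _; rewrite !eE SE.
  exists Q; split=> // [z y hy|z y].
    refine (sp z _ (subspace_preim (Qlin.1 y) (sym_span_subspace c)) _).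
    move=> _ [p [n [hp ->]]]; have [a [Na _ ->]] := QE p y hp.
    exact: sym_span_Ad.
  have B' : bilin (fun u v => Q v y * eta u).
    split=> [v|u]; first exact: (lin_comp ((amul_bilin A).2 _) (linearP eta)).
    exact: (lin_comp ((amul_bilin A).1 _) (Qlin.1 y)).
  apply: (eq_on_span (lin_tlift_comp B' (linearP _))
    (lin_comp ((amul_bilin A).1 y) (linearP eta)) _ (sp z)).
  move=> _ [p [n [hp ->]]]; rewrite (tlift_curve _ B' (curveP p hp)) cauchyC.
  have [a [_ eE E]] := QE p y hp; rewrite eE.
  transitivity (cauchy mulA (cauchy (fun u v : A => u * y * v) (dpow (i_ a))
      (dpow (- i_ a))) (dpow (i_ a)) n).
    by apply: eq_bigr => i _; rewrite E eE.
  rewrite (cauchyA (f' := fun u v : A => u * y * v) (g' := mulA)).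
  + transitivity (cauchy (fun u v : A => u * y * v) (dpow (i_ a))
      (fun i => (i == 0%N)%:R *: 1) n); last first.
      by rewrite cauchy_deltar ?mulr1 // => x; apply: (amul_bilin A).2.
    apply: eq_bigr => i _; congr (_ * _).
    by have := dpow_inv char0 (- i_ a) (n - i); rewrite opprK.
  + exact: (amul_bilin A).1.
  + by move=> x; apply: (amul_bilin A).2.
  + by move=> x y' w; rewrite mulrA.
Qed.
End Factorization.

(** * The coalgebra [U(g) / U(g) s] as a module over [U(g)] *)

Section UtauModule.
Variables (k : fieldType) (char0 : [pchar k] =i pred0) (g : lieAlgType k).
Variables (s c : {pred g}) (hc : submod_closed c).
Hypothesis sc : forall x, exists a b, [/\ a \in s, b \in c & x = a + b].
Variable mul : {bilinear Utau s -> Utau s -> Utau s}.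
Hypothesis hmul : is_Utau_product c mul.
Local Notation A := (uea g).
Local Notation U := (Utau s).
Local Notation i_ := (@uea_inj k g).
Local Notation cl := (Utau_class s).
Local Notation mulA := (fun x y : A => x * y).
Local Notation Acurve := (curve (@uea_comul k g) (@uea_counit k g)).
Local Notation Ucurve := (curve (@Utau_comul k g s) (@Utau_counit k g s)).
Local Notation one := (Utau_one s).

Definition act (z : A) (x : U) : U := cl (z * repr x).

Lemma actE z u : act z (cl u) = cl (z * u).
Proof.
by apply/Utau_classP; rewrite -mulrBr; apply/left_idealM/Utau_reprP.
Qed.

Lemma act_bilin : bilin act.
Proof.
split=> [x|z] a; last do 2!elim/Utau_ind=> ?.
  by elim/Utau_ind: x => u z w; rewrite !actE mulrDl -scalerAl linearP.
by rewrite -linearP !actE mulrDr -scalerAr linearP.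
Qed.

Lemma actM z w x : act (z * w) x = act z (act w x).
Proof. by elim/Utau_ind: x => u; rewrite !actE mulrA. Qed.

Lemma act1 x : act 1 x = x.
Proof. by elim/Utau_ind: x => u; rewrite actE mul1r. Qed.

Lemma act_one z : act z one = cl z.
Proof. by rewrite actE mulr1. Qed.

Lemma act_dpow_eq a b n x :
  (forall y, act a y = act b y) -> act (dpow a n) x = act (dpow b n) x.
Proof.
move=> e; rewrite /dpow !(linear_atZ _ _ (act_bilin.1 x)); congr (_ *: _).
by elim: n x => [|n IH] x; rewrite ?expr0 // !exprS !actM IH e.
Qed.

Lemma Utau_curve p : Acurve p -> Ucurve (fun n => cl (p n)).
Proof.
move=> hp; split=> n; last by rewrite Utau_counitE hp.2.
rewrite Utau_comulE hp.1 linear_sum; apply: eq_bigr => i _ /=.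
exact: tmapE.
Qed.

Definition exp_class (p : nat -> U) : Prop :=
  exists a, a \in c /\ p = fun n => cl (dpow (i_ a) n).

Lemma exp_class_curve p : exp_class p -> Ucurve p.
Proof. by move=> [a [_ ->]]; apply/Utau_curve/curve_dpow. Qed.

Lemma exp_class_span x : span (fun y => exists p n, exp_class p /\ y = p n) x.
Proof.
elim/Utau_ind: x => u; have [n [w hw hu]] := uea_filt char0 hc sc u.
have -> : cl u = cl w by apply/Utau_classP.
refine (hw _ (subspace_preim (linearP cl) (span_subspace _)) _).
move=> _ [a [m [ac _ ->]]]; rewrite expr_dpow // linearZ.
apply: (subspaceZ (span_subspace _)); apply: span_gen.
by exists (fun n => cl (dpow (i_ a) n)), m; split=> //; exists a.
Qed.

Lemma Utau_curve_spanned : curve_spanned (@Utau_comul k g s) (@Utau_counit k g s).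
Proof. exact: G_curve_spanned exp_class_curve exp_class_span. Qed.

(** The symmetrized product formula for a constant family, divided by [n!]. *)
Lemma mul_sym_span x p : sym_span c p -> mul x (cl p) = act p x.
Proof.
have l1 : linear (fun p => mul x (cl p)) by move=> a y z; rewrite linearP linearPr.
move: p; apply: (eq_on_span l1 (act_bilin.1 x)) => _ [a [n [ac ->]]].
elim/Utau_ind: x {l1} => u; have /= := hmul u (n := n) (x := fun=> a) (fun=> ac).
rewrite !prodr_const !card_ord !sumr_const -!scaler_nat linearZr_LR actE.
move/(congr1 (fun x => (#|'S_n|%:R : k)^-1 *: x)); rewrite !scalerA mulVf ?scale1r //.
by rewrite card_Sn fact_char0_neq0.
Qed.

Lemma mul_exp x a n : a \in c -> mul x (cl (dpow (i_ a) n)) = act (dpow (i_ a) n) x.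
Proof. by move=> ac; apply: mul_sym_span; apply: sym_span_dpow. Qed.

(** The linear section of [U(g) -> Utau] with values in the symmetric powers of
[c]: the convolution exponential of a linear section of [c -> Utau]. *)
Lemma sym_section : exists iota : {linear U -> A},
  [/\ curve_map (@Utau_comul k g s) (@Utau_counit k g s)
                (@uea_comul k g) (@uea_counit k g) iota,
      forall v, sym_span c (iota v), forall v, cl (iota v) = v & iota one = 1].
Proof.
have psi_lin : linear (fun v => \sw_(v1, v2 <- @Utau_comul k g s v) mul v1 v2).
  by apply: lin_tlift_comp; [exact: bilinP|exact: linearP].
have [|pr prE] := @degree_one k char0 U exp_class exp_class_span (mklin psi_lin).
  move=> _ n [a [ac ->]] /=.
  rewrite (tlift_curve _ (bilinP mul) (Utau_curve (curve_dpow char0 a))).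
  rewrite cauchyC natrX -linearZ -dpow_scale scaler_nat mulr2n -dpowD //.
  rewrite linear_sum; apply: eq_bigr => i _ /=.
  by rewrite mul_exp // actE.
have prc v : exists b, b \in c /\ cl (i_ b) = pr v.
  have hP : subspace (fun v => exists b, b \in c /\ cl (i_ b) = pr v).
    split=> [|a x y [b [bc hb]] [b' [bc' hb']]].
      by exists 0; rewrite uea_inj0 !linear0; split=> //; apply: hc.1.
    exists (a *: b + b'); split; first exact: hc.2.
    by rewrite uea_injD uea_injZ !linearP /= hb hb'.
  refine (exp_class_span v hP _) => _ [_ [n [[a [ac ->]] ->]]].
  exists ((n == 1%N)%:R *: a); rewrite (prE (fun n => cl (dpow (i_ a) n))); last by exists a.
  split; first exact: (subspaceZ (subspace_mem hc)).
  by rewrite uea_injZ linearZ dpow1.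
have [v|a v w v' w' [b [bc -> e]] [b' [bc' -> e']]|l hl] :=
    @linear_selection k U A (fun v w => exists b, [/\ b \in c, w = i_ b & cl w = pr v]).
- by have [b [bc e]] := prc v; exists (i_ b), b.
- exists (a *: b + b'); split; first exact: hc.2.
    by rewrite uea_injD uea_injZ.
  by rewrite !linearP /= e e'.
have [|iota iE] := @exp_lift k U _ _ _ exp_class_curve exp_class_span pr _ A l.
  exact: prE.
have iotaE a : a \in c -> exists b, [/\ b \in c, forall x, act (i_ b) x = act (i_ a) x
    & forall n, iota (cl (dpow (i_ a) n)) = dpow (i_ b) n].
  move=> ac; have ha : exp_class (fun n => cl (dpow (i_ a) n)) by exists a.
  have [b [bc lb clb]] := hl (cl (dpow (i_ a) 1)).
  exists b; split=> // [x|n]; last by rewrite (iE _ _ ha) lb.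
  rewrite -(expr1 (i_ b)) -(expr1 (i_ a)) -!mul_sym_span; try exact: sym_span_pow.
  by rewrite !expr1 -lb clb (prE _ _ ha) scale1r dpow1.
exists iota; split.
- apply: (curve_map_gen exp_class_curve exp_class_span (linearP iota)).
  move=> _ [a [ac ->]]; have [b [bc _ E]] := iotaE a ac.
  rewrite (_ : _ \o _ = dpow (i_ b)); first exact: curve_dpow.
  exact: funext.
- move=> v.
  refine (exp_class_span v (subspace_preim (linearP iota) (sym_span_subspace c)) _).
  move=> _ [_ [n [[a [ac ->]] ->]]]; have [b [bc _ ->]] := iotaE a ac.
  exact: sym_span_dpow.
- move=> v; apply: (eq_on_span (lin_comp (linearP cl) (linearP iota)) (@lin_id k U)
    _ (exp_class_span v)) => _ [_ [n [[a [ac ->]] ->]]].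
  have [b [bc e ->]] := iotaE a ac.
  by rewrite -[LHS]act_one (act_dpow_eq _ _ e) act_one.
- have [b [bc _ E]] := iotaE 0 hc.1; have := E 0%N.
  by rewrite !dpow0.
Qed.
End UtauModule.

(** * Left division *)

Section LeftDivision.
Variables (k : fieldType) (U : lmodType k).
Variables (D : {linear U -> tensor U U}) (e : {scalar U}) (G : (nat -> U) -> Prop).
Variables (mul : {bilinear U -> U -> U}) (one : U).
Hypothesis Gcurve : forall p, G p -> curve D e p.
Hypothesis spG : forall z, span (fun y => exists p n, G p /\ y = p n) z.
Hypothesis G0 : forall p, G p -> p 0%N = one.
Hypothesis mul1u : forall u, mul one u = u.

Let ev_bilin : bilin (fun u v : U => e u *: v).
Proof.
split=> [v|u]; last exact: lin_scale.
by apply: lin_scalar => c x y; rewrite linearP.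
Qed.

Let ev (t : tensor U U) : U := \sw_(u, v <- t) (e u *: v).

Let ev_lin : linear ev. Proof. exact: tlift_lin. Qed.

Let M_body u v : tensor U U := \sw_(u1, u2 <- D u) (u1 \ot mul u2 v).

Let M_inner v : bilin (fun u1 u2 : U => u1 \ot mul u2 v).
Proof.
split=> [u2|u1]; first exact: (tpure_bilin _ _).1.
exact: (lin_comp ((tpure_bilin _ _).2 _) ((bilinP mul).1 _)).
Qed.

Let M_bilin : bilin M_body.
Proof.
split=> [v|u]; first exact: (lin_tlift_comp (M_inner v) (linearP D)).
by apply: lin_tlift => u1 u2; exact: (lin_comp ((tpure_bilin _ _).2 _) ((bilinP mul).2 _)).
Qed.

Let M := tlift M_body.

Let M_lin : linear M. Proof. exact: tlift_lin. Qed.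

(** [u (x) v |-> u_(1) (x) u_(2) v] is unipotent, which inverts it. *)
Lemma left_translation_inv : exists I : {linear tensor U U -> tensor U U},
  forall u v, I (\sw_(u1, u2 <- D u) (u1 \ot mul u2 v)) = u \ot v.
Proof.
pose T t := t - M t.
have T_lin : linear T by apply: (lin_sub (@lin_id k _) M_lin).
have it_lin n : linear (iter n T).
  by elim: n => [|n IH] //; exact: (lin_comp T_lin IH).
have T_nil p n v : G p -> iter n.+1 T (p n \ot v) = 0.
  move=> hp; elim/ltn_ind: n v => n IH v.
  rewrite iterSr {2}/T /M tlift_pure // /M_body.
  rewrite (tlift_curve _ (M_inner v) (Gcurve hp)) /cauchy big_ord_recr /= subnn.
  rewrite G0 // mul1u opprD addrCA subrr addr0 -scaleN1r.
  rewrite (linear_atZ _ _ (it_lin n)) (lin_sumE _ _ (it_lin n)) big1 ?scaler0 // => i _.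
  by rewrite -[n in iter n](subnK (ltn_ord i)) iterD IH // (linear_at0 (it_lin _)).
pose S (t : tensor U U) := exists p n v, G p /\ t = p n \ot v.
have spS t : span S t.
  have hS := span_subspace S.
  elim/tensor_ind: t => [|x y hx hy|u v]; [exact: (subspace0 hS)|exact: (subspaceD hS)|].
  refine (spG u (subspace_preim ((tpure_bilin U U).1 v) hS) _).
  by move=> _ [p [n [hp ->]]]; apply: span_gen; exists p, n, v.
have [|I [IK _]] := loc_nilpotent_inv T_lin spS.
  by move=> _ [p [n [v [hp ->]]]]; exists n.+1; apply: T_nil.
exists I => u v; rewrite -[RHS]IK /T opprB addrC subrK /M tlift_pure //.
Qed.

(** The division [u \ v] is the counit applied to the first factor of the inverse
of [left_translation_inv]. *)
Lemma left_division : exists ld : {bilinear U -> U -> U},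
  (forall u v, \sw_(u1, u2 <- D u) ld u1 (mul u2 v) = e u *: v) /\
  (forall u v, \sw_(u1, u2 <- D u) mul u1 (ld u2 v) = e u *: v).
Proof.
have [I IM] := left_translation_inv.
have ld_bilin : bilin (fun u v : U => ev (I (u \ot v))).
  split=> [v|u]; apply: (lin_comp (lin_comp ev_lin (linearP I))).
    exact: (tpure_bilin _ _).1.
  exact: (tpure_bilin _ _).2.
pose ld := mkbilin ld_bilin.
have ldM u v : \sw_(u1, u2 <- D u) ld u1 (mul u2 v) = e u *: v.
  rewrite -[RHS](tlift_pure u v ev_bilin) -/(ev _) -IM.
  by rewrite (linear_comp_tlift _ _ (lin_comp ev_lin (linearP I))).
exists ld; split=> // u v.
have B : bilin (fun u1 u2 : U => mul u1 (ld u2 v)).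
  split=> [u2|u1]; first exact: (bilinP mul).1.
  exact: (lin_comp ((bilinP mul).2 _) ((bilinP ld).1 _)).
apply: (eq_on_span (lin_tlift_comp B (linearP D)) (ev_bilin.1 v) _ (spG u)).
move=> _ [p [n [hp ->]]]; have cp := Gcurve hp; rewrite (tlift_curve _ B cp) cp.2.
have ld_mul w : bilin (fun u1 u2 : U => ld u1 (mul u2 w)).
  split=> [u2|u1]; first exact: (bilinP ld).1.
  exact: (lin_comp ((bilinP ld).2 _) ((bilinP mul).1 _)).
have KL V m : cauchy ld p (cauchy mul p V) m = V m.
  rewrite -(cauchyA (f := fun t w => \sw_(u1, u2 <- t) ld u1 (mul u2 w))
                    (g := @tpure k U U)).
  - transitivity (cauchy (fun (a : k^o) w => a *: w)
        (fun i => (i == 0%N)%:R *: (1 : k^o)) V m); last first.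
      by rewrite cauchy_deltal ?scale1r // => y; apply: lin_scalar.
    by apply: eq_bigr => i _; rewrite -cp.1 ldM cp.2 [_ *: 1]mulr1.
  - by move=> w; apply: tlift_lin.
  - exact: (bilinP ld).2.
  - by move=> x y w; rewrite tlift_pure.
have ld0 w : ld (p 0%N) w = w.
  have := ldM (p 0%N) w; rewrite (tlift_curve _ (ld_mul w) cp) cp.2 scale1r.
  by rewrite /cauchy big_ord1 G0 // mul1u.
(* [ld] inverts [mul] on one side; being unipotent it does so on the other. *)
pose V m : U := (m == 0%N)%:R *: v.
pose Y m := cauchy mul p (cauchy ld p V) m - V m.
have Y0 m : Y m = 0.
  elim/ltn_ind: m => m IH; have : cauchy ld p Y m = 0.
    have -> : cauchy ld p Y m =
        cauchy ld p (cauchy mul p (cauchy ld p V)) m - cauchy ld p V m.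
      by rewrite /cauchy -sumrB; apply: eq_bigr => i _; rewrite linearBr.
    by rewrite KL subrr.
  rewrite /cauchy big_ord_recl subn0 ld0 big1 ?addr0 // => i _.
  by rewrite IH ?linear0r // ltn_subrL /=; case: m i {IH} => [[]|].
have E : V n = cauchy mul p (cauchy ld p V) n.
  by apply/esym/eqP; rewrite -subr_eq0; apply/eqP/Y0.
rewrite -/(V n) E; apply: eq_bigr => i _.
by rewrite cauchy_deltar //; exact: (bilinP ld).2.
Qed.
End LeftDivision.

(** * The Hopf algebra structure *)

Section UtauHopf.
Variables (k : fieldType) (char0 : [pchar k] =i pred0) (g : lieAlgType k).
Variables (s c : {pred g}) (hc : submod_closed c).
Hypothesis sc : forall x, exists a b, [/\ a \in s, b \in c & x = a + b].
Variable mul : {bilinear Utau s -> Utau s -> Utau s}.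
Hypothesis hmul : is_Utau_product c mul.
Local Notation A := (uea g).
Local Notation U := (Utau s).
Local Notation i_ := (@uea_inj k g).
Local Notation cl := (Utau_class s).
Local Notation mulA := (fun x y : A => x * y).
Local Notation Acurve := (curve (@uea_comul k g) (@uea_counit k g)).
Local Notation Ucurve := (curve (@Utau_comul k g s) (@Utau_counit k g s)).
Local Notation one := (Utau_one s).
Local Notation D := (@Utau_comul k g s).
Local Notation e := (@Utau_counit k g s).

Variable iota : {linear U -> A}.
Hypothesis iota_map : curve_map D e (@uea_comul k g) (@uea_counit k g) iota.
Hypothesis iota_sym : forall v, sym_span c (iota v).
Hypothesis iotaK : forall v, cl (iota v) = v.
Hypothesis iota1 : iota one = 1.

Let spU : curve_spanned D e. Proof. exact: (Utau_curve_spanned char0 hc sc). Qed.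

Lemma mul_act x v : mul x v = act (iota v) x.
Proof. by rewrite -[in LHS](iotaK v) (mul_sym_span char0 hmul). Qed.

Lemma comul_act z x : D (act z x) =
  \sw_(z1, z2 <- uea_comul z) \sw_(x1, x2 <- D x) (act z1 x1 \ot act z2 x2).
Proof.
elim/Utau_ind: x => X; rewrite actE !Utau_comulE rmorphM /=.
have [B1 B2] := sw_mul_bilin (act_bilin s).
have [T1 T2] : linear (tmap cl cl) /\ bilin (@amul k (tensor A A)).
  by split; [exact: linearP|exact: amul_bilinear].
elim/tensor_ind: (uea_comul z) => [|t t' h h'|a b].
- by rewrite mul0r (linear_at0 T1) (linear_at0 (B1 _)).
- by rewrite mulrDl (linear_atD _ _ T1) (linear_atD _ _ (B1 _)) h h'.
elim/tensor_ind: (uea_comul X) => [|t t' h h'|a' b'].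
- by rewrite mulr0 (linear_at0 T1) (linear_at0 (B2 _)).
- by rewrite mulrDr !(linear_atD _ _ T1) (linear_atD _ _ (B2 _)) h h'.
by rewrite uea_tensorM !tmapE sw_mul_pure ?actE //; exact: act_bilin.
Qed.

Lemma counit_act z x : e (act z x) = uea_counit z * e x.
Proof. by elim/Utau_ind: x => X; rewrite actE !Utau_counitE rmorphM. Qed.

Lemma tlift_tpure (V W : lmodType k) (t : tensor V W) : tlift (@tpure k V W) t = t.
Proof. by rewrite [RHS]tensor_sum. Qed.

Lemma tlift_exchange (V W X Y Z : lmodType k) (F : V -> W -> X -> Y -> Z) t t' :
  \sw_(a, b <- t) \sw_(a', b' <- t') F a b a' b' =
  \sw_(a', b' <- t') \sw_(a, b <- t) F a b a' b'.
Proof. exact: exchange_big. Qed.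

Lemma Utau_bialgebra : unital_bialgebra mul one D e.
Proof.
have D1 : D one = one \ot one by rewrite Utau_comulE rmorph1; exact: tmapE.
split=> //.
- by move=> u; rewrite mul_act act_one iotaK.
- by move=> u; rewrite mul_act iota1 act1.
- move=> u; rewrite (sw_coassoc spU (F := fun a b c => a \ot (b \ot c))); last first.
    split=> [b c'|a c'|a b]; first exact: (tpure_bilin _ _).1.
      exact: (lin_comp ((tpure_bilin _ _).2 _) ((tpure_bilin _ _).1 _)).
    exact: (lin_comp ((tpure_bilin _ _).2 _) ((tpure_bilin _ _).2 _)).
  apply: tlift_ext => a b /=; rewrite -[in RHS](tlift_tpure (D b)).
  by rewrite (linear_comp_tlift _ _ ((tpure_bilin _ _).2 _)).
- move=> u; rewrite -[RHS]tlift_tpure; apply/esym/(sw_cocomm spU).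
  exact: tpure_bilin.
- by move=> u; rewrite (sw_counitl spU (f := id)).
- by move=> u; rewrite (sw_counitr spU (f := id)).
- move=> u v; rewrite mul_act /= comul_act (sw_map spU (linearP iota) iota_map).
    rewrite /tmul [RHS]tlift_exchange; apply: tlift_ext => v1 v2.
    by apply: tlift_ext => u1 u2; rewrite !mul_act.
  exact: (sw_mul_bilinl (act_bilin s)).
- by rewrite /= [LHS]Utau_counitE rmorph1.
- move=> u v; rewrite mul_act /= counit_act mulrC; congr (_ * _).
  exact: (counit_map spU (linearP iota) iota_map).
Qed.

Section Divisions.
Variable S : {linear A -> A}.
Hypothesis SV : forall p n, Acurve p ->
  cauchy mulA (fun i => S (p i)) p n = (n == 0%N)%:R *: 1.
Hypothesis VS : forall p n, Acurve p ->
  cauchy mulA p (fun i => S (p i)) n = (n == 0%N)%:R *: 1.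

(** Right multiplication by [v] is the action of [iota v], so that right division
by [v] is the action of its antipode. *)
Lemma rd_bilin : bilin (fun u v : U => act (S (iota v)) u).
Proof.
split=> [v|u]; first exact: (act_bilin s).2.
exact: (lin_comp ((act_bilin s).1 _) (lin_comp (linearP S) (linearP iota))).
Qed.

Definition rdiv : {bilinear U -> U -> U} := mkbilin rd_bilin.

Lemma Utau_nahopf : exists ld : {bilinear U -> U -> U}, nahopf mul one D e ld rdiv.
Proof.
have HB := Utau_bialgebra.
have G0 (p : nat -> U) : exp_class c p -> p 0%N = one by move=> [a [_ ->]]; rewrite dpow0.
have [ld [h1 h2]] := left_division (exp_class_curve char0 (s := s) (c := c))
  (exp_class_span char0 hc sc) G0 (bialg_mul1u HB).
exists ld; split=> // u v.
- have B : bilin (fun v1 v2 => rdiv (mul u v1) v2).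
    split=> [v2|v1]; last exact: (bilinP rdiv).2.
    exact: (lin_comp ((bilinP rdiv).1 _) ((bilinP mul).2 _)).
  have L : linear (fun v => e v *: u) by apply: lin_scalar => a x y; rewrite linearP.
  move: v; apply: (eq_on_curves spU (lin_tlift_comp B (linearP D)) L) => p n hp.
  have cp := iota_map hp.
  rewrite (tlift_curve _ B hp) hp.2 cauchyC.
  transitivity (act (cauchy mulA (fun i => S (iota (p i))) (iota \o p) n) u).
    rewrite (lin_sumE _ _ ((act_bilin s).1 u)); apply: eq_bigr => i _ /=.
    by rewrite mul_act actM.
  by rewrite SV // (linear_atZ _ _ ((act_bilin s).1 u)) act1.
- have B : bilin (fun v1 v2 => mul (rdiv u v1) v2).
    split=> [v2|v1]; last exact: (bilinP mul).2.
    exact: (lin_comp ((bilinP mul).1 _) ((bilinP rdiv).2 _)).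
  have L : linear (fun v => e v *: u) by apply: lin_scalar => a x y; rewrite linearP.
  move: v; apply: (eq_on_curves spU (lin_tlift_comp B (linearP D)) L) => p n hp.
  have cp := iota_map hp.
  rewrite (tlift_curve _ B hp) hp.2 cauchyC.
  transitivity (act (cauchy mulA (iota \o p) (fun i => S (iota (p i))) n) u).
    rewrite (lin_sumE _ _ ((act_bilin s).1 u)); apply: eq_bigr => i _ /=.
    by rewrite mul_act actM.
  by rewrite VS // (linear_atZ _ _ ((act_bilin s).1 u)) act1.
Qed.
End Divisions.

Lemma lnprod_lin n x : linear (lnprod mul D e n x).
Proof.
elim: n => [|n IH] /=; first by apply: lin_scalar => a y z; rewrite linearP.
apply: lin_tlift_comp (linearP D); split=> [b|a]; last exact: (bilinP mul).2.
exact: (lin_comp ((bilinP mul).1 _) IH).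
Qed.

(** As [exp (s a)] is group-like, it is each of the [n] factors of the left-normed
product, and its [n]-th power is [exp (n s a)]. *)
Lemma lnprod_exp n x a m : a \in c ->
  lnprod mul D e n x (cl (dpow (i_ a) m)) = act (dpow (i_ (n%:R *: a)) m) x.
Proof.
move=> ac; elim: n x m => [|n IH] x m /=.
  rewrite Utau_counitE (curve_dpow char0 a).2 scale0r uea_inj0 dpow_zero.
  by rewrite (linear_atZ _ _ ((act_bilin s).1 x)) act1.
rewrite (tlift_curve (F := fun y1 y2 => mul (lnprod mul D e n x y1) y2) m _
  (Utau_curve s (curve_dpow char0 a))); last first.
  split=> [b|b]; last exact: (bilinP mul).2.
  exact: (lin_comp ((bilinP mul).1 _) (lnprod_lin n x)).
have -> : i_ (n.+1%:R *: a) = i_ a + i_ (n%:R *: a).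
  by rewrite -uea_injD -[in RHS](scale1r a) scalerA mulr1 -scalerDl -natr1 addrC.
rewrite cauchyC -dpowD //; last by rewrite uea_injZ -scalerAl -scalerAr.
rewrite (lin_sumE _ _ ((act_bilin s).1 x)); apply: eq_bigr => i _.
by rewrite IH (mul_exp char0 hmul) // actM.
Qed.

Lemma Utau_right_monoalternative : right_monoalternative mul one D e.
Proof.
move=> n x y.
apply: (eq_on_span (lnprod_lin n x)
  (lin_comp ((bilinP mul).2 x) (lnprod_lin n one)) _ (exp_class_span char0 hc sc y)).
move=> _ [_ [m [[a [ac ->]] ->]]]; rewrite !lnprod_exp // act_one (mul_exp char0 hmul) //.
exact: (subspaceZ (subspace_mem hc)).
Qed.
End UtauHopf.

(** * Hypospeciality *)

Section Hypospecial.
Variables (k : fieldType) (char0 : [pchar k] =i pred0) (g : lieAlgType k).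
Variables (s c : {pred g}) (hc : submod_closed c).
Hypothesis sc : forall x, exists a b, [/\ a \in s, b \in c & x = a + b].
Variable mul : {bilinear Utau s -> Utau s -> Utau s}.
Hypothesis hmul : is_Utau_product c mul.
Local Notation A := (uea g).
Local Notation U := (Utau s).
Local Notation C := (tensor (Utau s) (Utau s)).
Local Notation cl := (Utau_class s).
Local Notation mulA := (fun x y : A => x * y).
Local Notation Acurve := (curve (@uea_comul k g) (@uea_counit k g)).
Local Notation one := (Utau_one s).
Local Notation D := (@Utau_comul k g s).
Local Notation e := (@Utau_counit k g s).
Local Notation DC := (tcomul (@Utau_comul k g s)).
Local Notation eC := (tcounit (@Utau_counit k g s)).

Variable iota : {linear U -> A}.
Hypothesis iota_map : curve_map D e (@uea_comul k g) (@uea_counit k g) iota.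
Hypothesis iota_sym : forall v, sym_span c (iota v).
Hypothesis iotaK : forall v, cl (iota v) = v.
Hypothesis iota1 : iota one = 1.

Variable S : {linear A -> A}.
Hypothesis S_map : curve_map (@uea_comul k g) (@uea_counit k g)
                             (@uea_comul k g) (@uea_counit k g) S.
Hypothesis SV : forall p n, Acurve p ->
  cauchy mulA (fun i => S (p i)) p n = (n == 0%N)%:R *: 1.

Variables tau eta : {linear A -> A}.
Hypothesis tau_map : curve_map (@uea_comul k g) (@uea_counit k g)
                               (@uea_comul k g) (@uea_counit k g) tau.
Hypothesis tau_sym : forall z, sym_span c (tau z).
Hypothesis tau1 : tau 1 = 1.
Hypothesis tau_eta : forall z, \sw_(u, v <- uea_comul z) (tau v * u) = eta z.

Variable Q : A -> A -> A.
Hypothesis Q_bilin : bilin Q.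
Hypothesis Q_sym : forall z y, sym_span c y -> sym_span c (Q z y).
Hypothesis Q_eta : forall z y,
  \sw_(u, v <- uea_comul z) (Q v y * eta u) = eta z * y.

Variable ld : {bilinear U -> U -> U}.
Hypothesis ldM : forall u v, \sw_(u1, u2 <- D u) ld u1 (mul u2 v) = e u *: v.

Let spU : curve_spanned D e. Proof. exact: (Utau_curve_spanned char0 hc sc). Qed.

Let spC_gen := tensor_curve_span char0 spU.

Let tensor_curveP r : tensor_curve D e r -> curve DC eC r.
Proof. by move=> [p [q [hp hq ->]]]; apply: curve_tensor. Qed.

Let spC : curve_spanned DC eC. Proof. exact: G_curve_spanned tensor_curveP spC_gen. Qed.

Let mulE x v : mul x v = act (iota v) x.
Proof. exact: (mul_act char0 hmul iota_sym iotaK). Qed.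

Let mulS x z : sym_span c z -> mul x (cl z) = act z x.
Proof. exact: (mul_sym_span char0 hmul). Qed.

Let HB : unital_bialgebra mul one D e.
Proof. exact: (Utau_bialgebra char0 hc sc hmul iota_map iota_sym iotaK iota1). Qed.

(** [x |-> (x u) v], as an element of the enveloping algebra. *)
Let two_body u v : A := iota v * iota u.

Let two_bilin : bilin two_body.
Proof.
split=> [v|u]; first exact: (lin_comp ((amul_bilin A).2 _) (linearP iota)).
exact: (lin_comp ((amul_bilin A).1 _) (linearP iota)).
Qed.

Let two : C -> A := tlift two_body.
Let two_lin : linear two. Proof. exact: tlift_lin. Qed.
Let twoE u v : two (u \ot v) = iota v * iota u. Proof. exact: tlift_pure. Qed.

Let prd : C -> U := tlift mul.
Let prd_lin : linear prd. Proof. exact: (tlift_lin (bilinP mul)). Qed.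
Let prdE u v : prd (u \ot v) = mul u v. Proof. exact: (tlift_pure _ _ (bilinP mul)). Qed.

Let two_map : curve_map DC eC (@uea_comul k g) (@uea_counit k g) two.
Proof.
apply: (curve_map_gen tensor_curveP spC_gen two_lin) => _ [p [q [hp hq ->]]].
rewrite (_ : _ \o _ = cauchy mulA (iota \o q) (iota \o p)).
  by apply: curve_mulA; apply: iota_map.
apply: funext => n /=; rewrite (lin_cauchy _ _ _ _ two_lin) cauchyC.
by apply: eq_bigr => i _; rewrite twoE.
Qed.

Let prd_map : curve_map DC eC D e prd.
Proof.
apply: (curve_map_gen tensor_curveP spC_gen prd_lin) => _ [p [q [hp hq ->]]].
rewrite (_ : _ \o _ = cauchy mul p q).
  by apply: (curve_cauchy (bilinP mul) (bialg_comulM HB) (bialg_counitM HB)).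
apply: funext => n /=; rewrite (lin_cauchy _ _ _ _ prd_lin).
by apply: eq_bigr => i _; rewrite prdE.
Qed.

Let h_body c1 c2 : A := S (iota (prd c2)) * two c1.

Let h_bilin : bilin h_body.
Proof.
split=> [c2|c1]; first exact: (lin_comp ((amul_bilin A).2 _) two_lin).
exact: (lin_comp ((amul_bilin A).1 _)
  (lin_comp (linearP S) (lin_comp (linearP iota) prd_lin))).
Qed.

(** The operator [r (u, v)], as an element of the enveloping algebra. *)
Let h (t : C) : A := \sw_(c1, c2 <- DC t) h_body c1 c2.

Let h_lin : linear h. Proof. exact: (lin_tlift_comp h_bilin (linearP DC)). Qed.

Let h_map : curve_map DC eC (@uea_comul k g) (@uea_counit k g) h.
Proof.
move=> p hp; rewrite (_ : _ \o _ = cauchy mulA (S \o (iota \o (prd \o p))) (two \o p)).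
  apply: curve_mulA; last exact: two_map.
  by apply: S_map; apply: iota_map; apply: prd_map.
by apply: funext => n /=; rewrite /h (tlift_curve _ h_bilin hp) cauchyC.
Qed.

(** In group terms [h = w^-1 v u], where [w o = v u o]. *)
Let cl_h t : cl (h t) = eC t *: one.
Proof.
have l1 : linear (fun t => cl (h t)) by apply: (lin_comp (linearP cl) h_lin).
have l2 : linear (fun t => eC t *: one).
  by apply: lin_scalar => a x y; rewrite linearP.
have two1 t' : cl (two t') = cl (iota (prd t')).
  apply: (tensor_ext (f := mklin (lin_comp (linearP cl) two_lin))
    (g := mklin (lin_comp (linearP cl) (lin_comp (linearP iota) prd_lin)))) => u v /=.
  by rewrite twoE prdE iotaK mulE -[in RHS](iotaK u) actE.
move: t; apply: (eq_on_curves spC l1 l2) => p n hp.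
have cp := iota_map (prd_map hp).
rewrite /h (tlift_curve _ h_bilin hp) cauchyC hp.2.
transitivity (cl (cauchy mulA (fun i => S (iota (prd (p i)))) (fun i => iota (prd (p i))) n)).
  rewrite !(lin_cauchy _ _ _ _ (linearP cl)); apply: eq_bigr => i _.
  have clM z w : cl (z * w) = act z (cl w) by rewrite actE.
  by rewrite /h_body /= !clM two1.
by rewrite (SV n cp) linearZ.
Qed.

Let circ_lin : linear (fun t => cl (tau (h t))).
Proof. exact: (lin_comp (linearP cl) (lin_comp (linearP tau) h_lin)). Qed.

Let circ := mklin circ_lin.

Let circ_map : curve_map DC eC D e circ.
Proof.
by move=> p hp; apply: (Utau_curve s (p := tau \o (h \o p))); apply/tau_map/h_map.
Qed.

Let tau_body : bilin (fun u v => tau v * u).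
Proof.
split=> [v|u]; first exact: (amul_bilin A).2.
exact: (lin_comp ((amul_bilin A).1 _) (linearP tau)).
Qed.

Let Q_body y : bilin (fun u v => Q v y * eta u).
Proof.
split=> [v|u]; first exact: (lin_comp ((amul_bilin A).2 _) (linearP eta)).
exact: (lin_comp ((amul_bilin A).1 _) (Q_bilin.1 y)).
Qed.

Let eta_h t : eta (h t) = \sw_(c1, c2 <- DC t) (tau (h c2) * h c1).
Proof. by rewrite -tau_eta (sw_map spC h_lin h_map _ tau_body). Qed.

Let eta_hM t y : eta (h t) * y = \sw_(c1, c2 <- DC t) (Q (h c2) y * eta (h c1)).
Proof. by rewrite -Q_eta (sw_map spC h_lin h_map _ (Q_body y)). Qed.

Let act_sw (x : U) (X Y : lmodType k) (F : X -> Y -> A) t :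
  act (tlift F t) x = \sw_(a, b <- t) act (F a b) x.
Proof. exact: (linear_comp_tlift _ _ ((act_bilin s).1 x)). Qed.

Let r_opE u v x : r_op mul D (rdiv iota S) u v x = act (h (u \ot v)) x.
Proof.
rewrite /h (sw_tensor _ _ _ h_bilin) act_sw; apply: tlift_ext => u1 u2.
rewrite act_sw; apply: tlift_ext => v1 v2.
by rewrite /h_body twoE prdE /= !actM -!mulE.
Qed.

Let H_opE u v x : H_op mul D (rdiv iota S) circ u v x = act (eta (h (u \ot v))) x.
Proof.
have B : bilin (fun c1 c2 => tau (h c2) * h c1).
  split=> [c2|c1]; first exact: (lin_comp ((amul_bilin A).2 _) h_lin).
  exact: (lin_comp ((amul_bilin A).1 _) (lin_comp (linearP tau) h_lin)).
rewrite eta_h (sw_tensor _ _ _ B) act_sw; apply: tlift_ext => u1 u2.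
rewrite act_sw; apply: tlift_ext => v1 v2.
by rewrite r_opE mulS // actM.
Qed.

(** In group terms [n o = t h o = t o]. *)
Let cl_eta t : cl (eta (h t)) = circ t.
Proof.
rewrite -[RHS](sw_counitl spC t circ_lin) -act_one eta_h act_sw.
apply: tlift_ext => c1 c2.
rewrite actM act_one cl_h (linear_atZ _ _ ((act_bilin s).2 _)).
by rewrite act_one.
Qed.

(** With [n = eta h], [n y n ^ -1] as an element of the coset space. *)
Let conj y t : U := cl (Q (h t) (iota y)).

Let conj_lin y : linear (conj y).
Proof. exact: (lin_comp (linearP cl) (lin_comp (Q_bilin.1 _) h_lin)). Qed.

(** In group terms [n y o = (n y n^-1) n o = (n y n^-1) t o]. *)
Let act_eta_conj t y :
  act (eta (h t)) y = \sw_(c1, c2 <- DC t) mul (circ c1) (conj y c2).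
Proof.
rewrite -[in LHS](iotaK y) actE eta_hM (linear_comp_tlift _ _ (linearP cl)).
apply: tlift_ext => c1 c2.
by rewrite /conj (mulS _ (Q_sym _ (iota_sym y))) -cl_eta actE.
Qed.

(** By [act_eta_conj] the operator divided by [t] is a product by [t], and
coassociativity makes the two cancel. *)
Let H'_opE u v y : H'_op mul D ld (rdiv iota S) circ u v y = conj y (u \ot v).
Proof.
have B : bilin (fun c1 c2 => ld (circ c1) (act (eta (h c2)) y)).
  split=> [c2|c1]; first exact: (lin_comp ((bilinP ld).1 _) circ_lin).
  exact: (lin_comp ((bilinP ld).2 _)
    (lin_comp ((act_bilin s).1 y) (lin_comp (linearP eta) h_lin))).
transitivity (\sw_(c1, c2 <- DC (u \ot v)) ld (circ c1) (act (eta (h c2)) y)).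
  rewrite (sw_tensor _ _ _ B); apply: tlift_ext => u1 u2; apply: tlift_ext => v1 v2.
  by rewrite H_opE.
rewrite -(sw_counitl spC _ (conj_lin y)).
transitivity (\sw_(c1, c2 <- DC (u \ot v)) \sw_(d1, d2 <- DC c2)
    ld (circ c1) (mul (circ d1) (conj y d2))).
  apply: tlift_ext => c1 c2.
  by rewrite act_eta_conj (linear_comp_tlift _ _ ((bilinP ld).2 _)).
rewrite -(sw_coassoc spC (F := fun a b d => ld (circ a) (mul (circ b) (conj y d)))).
  apply: tlift_ext => c1 c2; rewrite -(counit_map spC circ_lin circ_map) -ldM.
  rewrite (sw_map spC circ_lin circ_map) //.
  split=> [b|a]; first exact: (bilinP ld).1.
  exact: (lin_comp ((bilinP ld).2 _) ((bilinP mul).1 _)).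
split=> [b d|a d|a b].
- exact: (lin_comp ((bilinP ld).1 _) circ_lin).
- exact: (lin_comp ((bilinP ld).2 _) (lin_comp ((bilinP mul).1 _) circ_lin)).
- exact: (lin_comp ((bilinP ld).2 _) (lin_comp ((bilinP mul).2 _) (conj_lin y))).
Qed.

(** The operation is trivial when [u] or [v] is the unit, because [h] is [w^-1 w]. *)
Let antipode_counit u : \sw_(u1, u2 <- D u) (S (iota u2) * iota u1) = e u *: 1.
Proof.
have B : bilin (fun u1 u2 => S (iota u2) * iota u1).
  split=> [u2|u1]; first exact: (lin_comp ((amul_bilin A).2 _) (linearP iota)).
  exact: (lin_comp ((amul_bilin A).1 _) (lin_comp (linearP S) (linearP iota))).
have L : linear (fun u => e u *: (1 : A)).
  by apply: lin_scalar => a x y; rewrite linearP.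
move: u; apply: (eq_on_curves spU (lin_tlift_comp B (linearP D)) L) => p n hp.
rewrite (tlift_curve _ B hp) hp.2 cauchyC -(SV n (iota_map hp)).
by [].
Qed.

Let cl_tau_counit a : cl (tau (a *: 1)) = a *: one.
Proof. by rewrite !linearZ /= tau1. Qed.

(** The last identity is [n y x = (n y n^-1) (n x)]. *)
Lemma Utau_right_hypospecial : right_hypospecial mul one D e ld (rdiv iota S).
Proof.
exists circ; split.
- split=> t.
    rewrite -[LHS]tlift_tpure (sw_map spC circ_lin circ_map _ (tpure_bilin _ _)).
    rewrite -[tensor_comul _ _ in RHS]tlift_tpure (linear_comp_tlift _ _ (linearP _)).
    by apply: tlift_ext => a b; exact/esym/tmapE.
  exact: (counit_map spC circ_lin circ_map).
- move=> u /=; rewrite -cl_tau_counit -antipode_counit; congr (cl (tau _)).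
  rewrite /h (sw_tensor _ _ _ h_bilin); apply: tlift_ext => u1 u2.
  rewrite (bialg_comul1 HB) tlift_pure; last first.
    split=> [v2|v1]; last exact: (lin_comp (h_bilin.2 _) ((tpure_bilin U U).2 _)).
    exact: (lin_comp (h_bilin.1 _) ((tpure_bilin U U).2 _)).
  by rewrite /h_body twoE prdE iota1 mul1r (bialg_mulu1 HB).
- move=> u /=; rewrite -cl_tau_counit -antipode_counit; congr (cl (tau _)).
  rewrite /h (sw_tensor _ _ _ h_bilin) (bialg_comul1 HB) tlift_pure; last first.
    split=> [u2|u1]; apply: lin_tlift => v1 v2.
      exact: (lin_comp (h_bilin.1 _) ((tpure_bilin U U).1 _)).
    exact: (lin_comp (h_bilin.2 _) ((tpure_bilin U U).1 _)).
  apply: tlift_ext => u1 u2.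
  by rewrite /h_body twoE prdE iota1 mulr1 (bialg_mul1u HB).
- move=> u v x y; rewrite H_opE mulE -actM eta_hM.
  have B : bilin (fun c1 c2 => Q (h c2) (iota y) * eta (h c1)).
    split=> [c2|c1].
      exact: (lin_comp ((amul_bilin A).2 _) (lin_comp (linearP eta) h_lin)).
    exact: (lin_comp ((amul_bilin A).1 _) (lin_comp (Q_bilin.1 _) h_lin)).
  rewrite (sw_tensor _ _ _ B) act_sw; apply: tlift_ext => u1 u2.
  rewrite act_sw; apply: tlift_ext => v1 v2.
  by rewrite H_opE H'_opE /conj (mulS _ (Q_sym _ (iota_sym y))) actM.
Qed.

End Hypospecial.

Theorem theorem4p6 (k : fieldType) (char0 : [pchar k] =i pred0)
    (g : lieAlgType k) (s c : {pred g}) (htau : hyporeductive_triple s c)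
    (mul : {bilinear Utau s -> Utau s -> Utau s})
    (hmul : is_Utau_product c mul) :
  hyporeductive_hopf mul (Utau_one s) (@Utau_comul k g s) (@Utau_counit k g s).
Proof.
have [[_ _ hc sc _] Nc] := htau.
have [iota [iota_map iota_sym iotaK iota1]] := sym_section char0 hc sc hmul.
have [S [S_map _ SV VS]] := uea_antipode char0 g.
have [tau [eta [[tau_map tau_sym tau1] tau_eta [Q [Q_bilin Q_sym Q_eta]]]]] :=
  normalizer_factorization char0 hc Nc.
have [ld hld] :=
  Utau_nahopf char0 hc sc hmul iota_map iota_sym iotaK iota1 SV VS.
exists ld, (rdiv iota S); split=> //.
  exact: (Utau_right_hypospecial char0 hc sc hmul iota_map iota_sym iotaK iota1
    S_map SV tau_map tau_sym tau1 tau_eta Q_bilin Q_sym Q_eta (nahopf_ldM hld)).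
exact: (Utau_right_monoalternative char0 hc sc hmul).
Qed.
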